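(* Every cluster algebra (of geometric type) with principal coefficients is a Laurent phenomenon algebra. That is: if $t_0=(\mathbf x_0,\tilde B_0)$ is a cluster algebra seed for which $\tilde B_0$ is a $2n\times n$ matrix whose bottom $n\times n$ submatrix is the identity matrix, then the cluster algebra $\mathcal A_{CA}(t_0)$, with each of its seeds $(\mathbf x,\tilde B)$ regarded as the pair $(\mathbf x,\mathbf F)$ of the cluster and its associated exchange polynomials, is a Laurent phenomenon algebra.
   Context: Cluster algebras of geometric type. Let $m\ge n\ge1$ and $S=\mathbb Z[x_{n+1}^{\pm1},\dots,x_m^{\pm1}]$ (frozen variables $x_{n+1},\dots,x_m$), and let $\mathcal F$ be the field of rational functions in $n$ independent variables over $\mathrm{Frac}(S)$. A cluster algebra seed in $\mathcal F$ is a pair $(\mathbf x,\tilde B)$ with $\mathbf x=\{x_1,\dots,x_n\}$ a transcendence basis of $\mathcal F$ over $\mathrm{Frac}(S)$ and $\tilde B=(b_{ij})$ an $m\times n$ integer matrix whose top $n\times n$ submatrix $B$ is skew-symmetrizable (there is a diagonal matrix $D$ with positive diagonal entries such that $DB$ is skew-symmetric). Its associated exchange polynomials are $F_j=\prod_{b_{ij}>0}x_i^{b_{ij}}+\prod_{b_{ij}<0}x_i^{-b_{ij}}$ for $j\in[n]=\{1,\dots,n\}$. Its cluster algebra mutation at $i\in[n]$ is $(\mathbf x',\tilde B')$ with $x_i'=F_i/x_i$, $x_j'=x_j$ for $j\ne i$, and $b'_{kj}=-b_{kj}$ if $k=i$ or $j=i$, $b'_{kj}=b_{kj}+\frac{|b_{ki}|b_{ij}+b_{ki}|b_{ij}|}{2}$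 otherwise. The cluster algebra $\mathcal A_{CA}(t_0)$ is the collection of all seeds obtained from $t_0$ by successive mutations, together with the subring of $\mathcal F$ generated over $S$ by all cluster variables in these seeds. Here $m=2n$. LP seeds. Let $S$ be a unique factorization domain and $\mathcal F$ the field of rational functions in $n$ independent variables over $\mathrm{Frac}(S)$. An LP seed of rank $n$ in $\mathcal F$ is a pair $(\mathbf x,\mathbf F)$ where $\mathbf x=\{x_1,\dots,x_n\}$ is a transcendence basis of $\mathcal F$ over $\mathrm{Frac}(S)$, and $\mathbf F=\{F_1,\dots,F_n\}$ are polynomials in $\mathcal P=S[x_1,\dots,x_n]$ such that (LP1) each $F_i$ is irreducible in $\mathcal P$ and not divisible by any $x_j$; (LP2) $F_i$ does not involve $x_i$. Sets are unordered, but it is recorded which $F_i$ belongs to which $x_i$. Write $f\propto g$ if $f,g$ differ multiplicatively by a unit of $S$. Exchange Laurent polynomials. For an LP seed, $\hat F_1,\dots,\hat F_n\in S[x_1^{\pm1},\dots,x_n^{\pm1}]$ are the unique elements such that $\hat F_i=\big(\prod_{k\ne i}x_k^{a_k}\big)F_i$ for some integers $a_k\le 0$, and for all $j\neq i$ the element $\hat F_i|_{x_j\leftarrow F_j/x}$ lies in $S[x_1^{\pm1},\dots,x_{j-1}^{\pm1},x^{\pm1},x_{j+1}^{\pm1},\dots,x_n^{\pm1}]$ and is not divisible by $F_j$ in this ring. LP mutation. For $i\in[n]$, $(\mathbf x',\mathbf F')$ is obtained from the LP seed $(\mathbf x,\mathbf F)$ by LP mutation at $i$ if it results from the following non-deterministic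 procedure. Put $x_i'=\hat F_i/x_i$ and $x_j'=x_j$ for $j\ne i$; $F_i'=F_i$. For $j\neq i$: if $F_j$ does not depend on $x_i$, then $F_j'$ is any polynomial in $\mathcal P'=S[x_1',\dots,x_n']$ with $F'_j\propto F_j$. If $F_j$ depends on $x_i$ (in which case $\hat F_i|_{x_j\leftarrow 0}$ is defined), put $G_j=F_j|_{x_i\leftarrow (\hat F_i|_{x_j\leftarrow0})/x_i'}$; let $H_j$ be $G_j$ with all common factors in $S[x_k:k\ne i,j]$ with $\hat F_i|_{x_j\leftarrow 0}$ removed (every irreducible factor of $\hat F_i|_{x_j\leftarrow0}$ is divided out of $G_j$ to the full power to which it divides $G_j$, monomials being immaterial); finally $F_j'=MH_j$ where $M$ is a Laurent monomial in the $x_k'$, $k\neq j$, with coefficient a unit in $S$, such that $F_j'\in\mathcal P'$, $F'_j$ does not involve $x'_j$, and $F_j'$ is not divisible by any variable of $\mathcal P'$. LP algebras. A Laurent phenomenon (LP) algebra of rank $n$ is a subring $\mathcal A\subset\mathcal F$ together with a distinguished collection of LP seeds in $\mathcal F$ such that: for each seed of the collection and each $i\in[n]$ we are given a seed of the collection obtained from it by LP mutation at $i$; all seeds are connected by mutations; and $\mathcal A$ is generated over $S$ by all cluster variables of all the seeds. *)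

(* Defs.v *)
From HB Require Import structures.
From mathcomp Require Import all_boot all_order all_algebra finmap mpoly.
From mathcomp Require boolp.
From Stdlib Require Import Relation_Operators.

Set Implicit Arguments.
Unset Strict Implicit.
Unset Printing Implicit Defensive.

Import GRing.Theory.
Local Open Scope ring_scope.

Notation "x %:F" := (tofrac x).

(* [laurent R n] is R[X_1^{+-1}, ..., X_n^{+-1}], realised as the subring of
   Frac(R[X_1, ..., X_n]) of the fractions whose denominator is a monomial. *)

Section Laurent.
Variables (R : idomainType) (n : nat).

Definition laurent_pred : pred {fraction {mpoly R[n]}} := fun z =>
  boolp.asbool (exists (a : 'X_{1..n}) (p : {mpoly R[n]}),
                  z = p%:F / ('X_[R, a])%:F).

Lemma laurent_predP z :
  reflect (exists (a : 'X_{1..n}) (p : {mpoly R[n]}),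
             z = p%:F / ('X_[R, a])%:F) (z \in laurent_pred).
Proof. exact: boolp.asboolP. Qed.

Lemma mpolyX_neq0 (a : 'X_{1..n}) : 'X_[R, a] != 0.
Proof. by rewrite -msupp_eq0 msuppX. Qed.

Lemma tofrac_mpolyX_neq0 (a : 'X_{1..n}) : ('X_[R, a])%:F != 0.
Proof. by rewrite tofrac_eq0 mpolyX_neq0. Qed.

Lemma laurent_subring_closed : subring_closed laurent_pred.
Proof.
split=> [|x y|x y].
- apply/laurent_predP; exists 0%MM, 1.
  by rewrite mpolyX0 tofrac1 divr1.
- move=> /laurent_predP[a [p ->]] /laurent_predP[b [q ->]].
  apply/laurent_predP; exists (a + b)%MM, (p * 'X_[b] - q * 'X_[a]).
  rewrite mpolyXD tofracB !tofracM -mulNr addf_div ?tofrac_mpolyX_neq0 //.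
  by rewrite mulNr.
- move=> /laurent_predP[a [p ->]] /laurent_predP[b [q ->]].
  apply/laurent_predP; exists (a + b)%MM, (p * q).
  by rewrite mpolyXD !tofracM mulf_div.
Qed.

HB.instance Definition _ := GRing.isSubringClosed.Build
  {fraction {mpoly R[n]}} laurent_pred laurent_subring_closed.

Record laurent := Laurent {
  laurent_val :> {fraction {mpoly R[n]}};
  _ : laurent_val \in laurent_pred }.

HB.instance Definition _ := [isSub for laurent_val].
HB.instance Definition _ := [Choice of laurent by <:].
HB.instance Definition _ := [SubChoice_isSubComNzRing of laurent by <:].

Definition laurent_unit : pred laurent := fun x =>
  (val x != 0) && ((val x)^-1 \in laurent_pred).
Definition laurent_inv (x : laurent) : laurent := insubd x (val x)^-1.

Lemma laurent_mulVr : {in laurent_unit, left_inverse 1 laurent_inv *%R}.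
Proof.
move=> x /andP[x0 xV]; apply: val_inj.
have -> : val (laurent_inv x * x) = val (laurent_inv x) * val x.
  exact: (rmorphM val).
by rewrite val_insubd xV mulVf // (rmorph1 val).
Qed.

Lemma laurent_unitP (x y : laurent) : y * x = 1 -> laurent_unit x.
Proof.
move=> yx1; have yx1' : val y * val x = 1 by rewrite -rmorphM yx1 rmorph1.
have x0 : val x != 0.
  by apply/eqP => x0; move/eqP: yx1'; rewrite x0 mulr0 eq_sym oner_eq0.
rewrite /laurent_unit x0 /=.
suff -> : (val x)^-1 = val y by exact: valP.
by rewrite -[LHS]mul1r -yx1' mulfK.
Qed.

Lemma laurent_invr_out : {in [predC laurent_unit], laurent_inv =1 id}.
Proof.
move=> x; rewrite inE /= /laurent_unit negb_and negbK /laurent_inv.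
move=> /orP[/eqP x0|xV]; apply: val_inj; rewrite val_insubd.
  by rewrite x0 invr0 if_same.
by rewrite (negbTE xV).
Qed.

HB.instance Definition _ := GRing.ComNzRing_hasMulInverse.Build laurent
  laurent_mulVr laurent_unitP laurent_invr_out.

Lemma laurent_integral : GRing.integral_domain_axiom laurent.
Proof.
move=> x y xy0; have : val x * val y == 0 by rewrite -rmorphM xy0 rmorph0.
by rewrite mulf_eq0 -!(inj_eq val_inj) rmorph0.
Qed.

HB.instance Definition _ :=
  GRing.ComUnitRing_isIntegral.Build laurent laurent_integral.

Lemma lpoly_subproof (p : {mpoly R[n]}) : p%:F \in laurent_pred.
Proof.
apply/laurent_predP; exists 0%MM, p.
by rewrite mpolyX0 tofrac1 divr1.
Qed.

Definition lpoly (p : {mpoly R[n]}) : laurent := Laurent (lpoly_subproof p).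
Definition lconst (c : R) : laurent := lpoly c%:MP.
Definition lvar (i : 'I_n) : laurent := lpoly 'X_i.

End Laurent.

Definition divides (R : comNzRingType) (a b : R) : Prop :=
  exists c : R, b = c * a.

Definition irreducible (R : idomainType) (p : R) : Prop :=
  [/\ p != 0, p \isn't a GRing.unit &
      forall a b : R, p = a * b -> a \is a GRing.unit \/ b \is a GRing.unit].

Definition involves (R : idomainType) (n : nat) (f : {mpoly R[n]}) (i : 'I_n)
    : bool :=
  has (fun a : 'X_{1..n} => a i != 0%N) (msupp f).

Definition set_coord (T : Type) (n : nat) (y : 'I_n -> T) (j : 'I_n) (v : T)
    : 'I_n -> T :=
  fun k => if k == j then v else y k.

(* Below, [S] stands for the ground ring.  Being a UFD is not needed to write
   the definitions down, so it is not recorded here; they are only used for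
   S = Z[y_1^{+-1}, ..., y_r^{+-1}], which is one. *)

Notation ambient S n := {fraction {mpoly {fraction S}[n]}}.

Section Ambient.
Variables (S : idomainType) (n : nat).
Local Notation K := (ambient S n).

Definition of_fracS (c : {fraction S}) : K := (c%:MP)%:F.
Definition of_S (c : S) : K := of_fracS c%:F.

Definition alg_independent (x : 'I_n -> K) : Prop :=
  forall p : {mpoly {fraction S}[n]}, mmap of_fracS x p = 0 -> p = 0.

Definition in_generated_field (x : 'I_n -> K) (z : K) : Prop :=
  exists p q : {mpoly {fraction S}[n]},
    mmap of_fracS x q != 0 /\ z = mmap of_fracS x p / mmap of_fracS x q.

Definition algebraic_over (x : 'I_n -> K) (z : K) : Prop :=
  exists P : {poly K},
    [/\ P != 0, forall k, in_generated_field x P`_k & root P z].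

Definition transcendence_basis (x : 'I_n -> K) : Prop :=
  alg_independent x /\ forall z, algebraic_over x z.

Inductive generated_subring (X : K -> Prop) : K -> Prop :=
| gen_const c : generated_subring X (of_S c)
| gen_elt z : X z -> generated_subring X z
| gen_sub z w : generated_subring X z -> generated_subring X w ->
    generated_subring X (z - w)
| gen_mul z w : generated_subring X z -> generated_subring X w ->
    generated_subring X (z * w).

(* A labelled presentation of an LP seed.  The exchange polynomials are kept
   as formal polynomials; the element of the ambient field is obtained by
   evaluating at the cluster (see [useed_of]). *)
Record lp_seed := LPSeed {
  lp_cluster : 'I_n -> K;
  lp_poly : 'I_n -> {mpoly S[n]} }.

Definition is_lp_seed (s : lp_seed) : Prop :=
  [/\ transcendence_basis (lp_cluster s),
      forall i, irreducible (lp_poly s i),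
      forall i j, ~ divides 'X_j (lp_poly s i) &
      forall i, ~~ involves (lp_poly s i) i].

(* An unordered seed, as the finite set of the pairs (x_i, F_i). *)
Local Notation useed := {fset K * K}.

Definition useed_of (s : lp_seed) : useed :=
  [fset (lp_cluster s i, mmap of_S (lp_cluster s) (lp_poly s i))
     | i in 'I_n]%fset.

Definition is_cluster_var (U : useed) (v : K) : Prop :=
  exists f : K, (v, f) \in U.

(* The value at y of the Laurent polynomial f / X^a, where a >= 0. *)
Definition leval (E : fieldType) (h : S -> E) (a : 'X_{1..n})
    (f : {mpoly S[n]}) (y : 'I_n -> E) : E :=
  mmap h y f / \prod_(k < n) y k ^+ a k.

(* Formal rational functions in the cluster variables, and the Laurent
   polynomial ring inside them. *)
Local Notation Kf := {fraction {mpoly S[n]}}.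
Local Notation L := (laurent S n).

Definition fconst (c : S) : Kf := (c%:MP)%:F.
Definition fvar (k : 'I_n) : Kf := ('X_k)%:F.

(* hat F_i = F_i / X^a.  Since F_j does not involve X_j, the new variable x of
   the substitution x_j <- F_j / x may again be called X_j. *)
Definition hat_exponent (s : lp_seed) (i : 'I_n) (a : 'X_{1..n}) : Prop :=
  a i = 0%N /\
  forall j, j != i ->
    exists q : L,
      val q = leval fconst a (lp_poly s i)
                (set_coord fvar j ((lp_poly s j)%:F / fvar j)) /\
      ~ divides (lpoly (lp_poly s j)) q.

(* The irreducible factors are those in S[x_k : k <> i, j].  Divisibility is
   tested in the Laurent polynomial ring, where the variables are units, so
   they have to be excluded. *)
Definition irreducible_factor (i j : 'I_n) (g : L) (p : {mpoly S[n]}) : Prop :=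
  [/\ irreducible p,
      ~~ involves p i /\ ~~ involves p j,
      forall k, ~ divides 'X_k p &
      divides (lpoly p) g].

Definition common_factors_removed (i j : 'I_n) (g G H : L) : Prop :=
  exists ps : seq {mpoly S[n]},
    [/\ forall p, p \in ps -> irreducible_factor i j g p,
        G = (\prod_(p <- ps) lpoly p) * H &
        forall p, irreducible_factor i j g p -> ~ divides (lpoly p) H].

Definition assoc_S (f g : {mpoly S[n]}) : Prop :=
  exists2 u : S, u \is a GRing.unit & g = u *: f.

(* In the formal rings, X_i stands for x_i in F_j and for x_i' in F_j'.  When
   F_j involves x_i, a j = 0, so that the denominator of
   [leval fconst a _ (set_coord fvar j 0)] does not vanish. *)
Definition lp_mutation (i : 'I_n) (s s' : lp_seed) : Prop :=
  let F := lp_poly s in let F' := lp_poly s' in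
  is_lp_seed s /\
  exists a : 'X_{1..n},
    [/\ hat_exponent s i a,
        forall j, lp_cluster s' j =
          if j == i then leval of_S a (F i) (lp_cluster s) / lp_cluster s i
          else lp_cluster s j,
        F' i = F i &
        forall j, j != i ->
          if ~~ involves (F j) i then assoc_S (F j) (F' j)
          else exists g H : L,
            [/\ val g = leval fconst a (F i) (set_coord fvar j 0),
                common_factors_removed i j g
                  (mmap (@lconst S n)
                     (set_coord (@lvar S n) i (g / lvar S i)) (F j)) H,
                exists u : S, exists m : 'I_n -> int,
                  u \is a GRing.unit /\
                  lpoly (F' j) =
                    lconst n u * \prod_(k < n | k != j) lvar S k ^ m k * H,
                ~~ involves (F' j) j &
                forall k, ~ divides 'X_k (F' j)]].

Definition ulp_mutation (v : K) (U U' : useed) : Prop :=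
  exists (i : 'I_n) (s s' : lp_seed),
    [/\ U = useed_of s, U' = useed_of s', v = lp_cluster s i &
        lp_mutation i s s'].

(* [mu] is the choice of mutated seeds; an index i of a seed is designated by
   its cluster variable, seeds being unordered.  That [A] is a subring follows
   from the last clause. *)
Definition is_lp_algebra (A : K -> Prop) (C : useed -> Prop) : Prop :=
  (forall U, C U -> exists2 s, is_lp_seed s & U = useed_of s) /\
  exists mu : useed -> K -> useed,
    [/\ forall U v, C U -> is_cluster_var U v ->
          C (mu U v) /\ ulp_mutation v U (mu U v),
        forall U U', C U -> C U' ->
          clos_refl_sym_trans _
            (fun V V' => C V /\ exists2 v, is_cluster_var V v & V' = mu V v)
            U U' &
        forall z, A z <->
          generated_subring (fun v => exists2 U, C U & is_cluster_var U v) z].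

End Ambient.

(* There are n mutable and r frozen variables, so m = n + r; the first n rows
   of the exchange matrix are the mutable ones. *)

Section ClusterAlgebra.
Variables (n r : nat).
Local Notation S := (laurent int r).
Local Notation K := (ambient S n).

Record cluster_seed := ClusterSeed {
  cs_cluster : 'I_n -> K;
  cs_matrix : 'M[int]_(n + r, n) }.

Definition skew_symmetrizable (B : 'M[int]_n) : Prop :=
  exists d : 'rV[rat]_n, (forall i, 0 < d 0 i) /\
    let DB := diag_mx d *m map_mx intr B in DB^T = - DB.

Definition is_cluster_seed (t : cluster_seed) : Prop :=
  transcendence_basis (cs_cluster t) /\
  skew_symmetrizable (usubmx (cs_matrix t)).

Definition extended_var (k : 'I_(n + r)) : {mpoly S[n]} :=
  match split k with
  | inl i => 'X_i
  | inr f => (lvar int f)%:MP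
  end.

Definition exchange_poly (B : 'M[int]_(n + r, n)) (j : 'I_n) : {mpoly S[n]} :=
  \prod_(k < n + r | 0 < B k j) extended_var k ^+ `|B k j|%N
  + \prod_(k < n + r | B k j < 0) extended_var k ^+ `|B k j|%N.

(* The numerator is always even, so that the division is exact. *)
Definition matrix_mutation (i : 'I_n) (B : 'M[int]_(n + r, n))
    : 'M[int]_(n + r, n) :=
  \matrix_(k, j)
    if (k == lshift r i) || (j == i) then - B k j
    else B k j +
      ((`|B k i| * B (lshift r i) j + B k i * `|B (lshift r i) j|) %/ 2)%Z.

Definition cluster_mutation (i : 'I_n) (t : cluster_seed) : cluster_seed :=
  let x := cs_cluster t in
  ClusterSeed
    (fun j => if j == i
              then mmap (@of_S S n) x (exchange_poly (cs_matrix t) i) / x i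
              else x j)
    (matrix_mutation i (cs_matrix t)).

Inductive cluster_reachable (t0 : cluster_seed) : cluster_seed -> Prop :=
| reach_refl : cluster_reachable t0 t0
| reach_mut t i : cluster_reachable t0 t ->
    cluster_reachable t0 (cluster_mutation i t).

Definition cluster_algebra (t0 : cluster_seed) : K -> Prop :=
  generated_subring
    (fun v => exists t i, cluster_reachable t0 t /\ v = cs_cluster t i).

Definition lp_seed_of_cluster_seed (t : cluster_seed) : lp_seed S n :=
  LPSeed (cs_cluster t) (exchange_poly (cs_matrix t)).

Definition cluster_lp_seeds (t0 : cluster_seed) : {fset K * K} -> Prop :=
  fun U => exists2 t, cluster_reachable t0 t &
    U = useed_of (lp_seed_of_cluster_seed t).

End ClusterAlgebra.

(* Main.v *)
Require Import Defs.
From HB Require Import structures.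
From mathcomp Require Import all_boot all_order all_algebra finmap mpoly.
From mathcomp Require Import ring zify.
From mathcomp Require boolp.
From Stdlib Require Import Relation_Operators.

Set Implicit Arguments.
Unset Strict Implicit.
Unset Printing Implicit Defensive.

Import Order.TTheory GRing.Theory Num.Theory.
Local Open Scope ring_scope.

(** Principal coefficients enter through a single property of the extended
    exchange matrix B: it has a left inverse M over the integers.  Matrix
    mutation multiplies B on both sides by integral involutions, so all seeds
    have this property ([integral_section_mutation]).  Write z for the vector of
    all mutable and frozen variables and b for a column of B; up to a monomial,
    the exchange polynomial of that column is 1 + z^b.

    By M, the morphism of tori given by the columns of B has a section: there
    are points at which the monomials z^b take any prescribed nonzero values.
    Hence at suitable points with coordinates 1 and -1 one exchange polynomial
    vanishes while another one does not ([exchange_point]), which settles the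
    questions of divisibility.  Moreover b is primitive, so it is part of
    a monomial change of coordinates in which the exchange polynomial is a unit
    times 1 + T, and therefore irreducible ([exchange_irreducible]).  So every
    cluster seed is an LP seed; that its cluster remains a transcendence basis
    is [transcendence_basis_exchange].

    A cluster mutation is an LP mutation ([cluster_mutation_lp]) for three
    reasons.  Substituting F_j / X_j for X_j in F_i leaves something not
    divisible by F_j, so the exchange Laurent polynomials are the exchange
    polynomials.  If F_j involves x_i, then by sign-skew-symmetry F_i involves
    x_j, and setting x_j = 0 in F_i leaves a single monomial; it has no
    irreducible factor, and nothing has to be removed from G_j.  Finally,
    substituting that monomial over x_i' for x_i in 1 + z^b transforms the
    exponent vector b by the mutation rule for matrices, so G_j and the mutated
    exchange polynomial differ by a Laurent monomial. *)

(** * Polynomials, their variables, and Laurent polynomials *)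

Section MmapFacts.
Variable n : nat.

Lemma mmapXU (R : nzRingType) (E : comNzRingType) (h : {rmorphism R -> E})
    (y : 'I_n -> E) (k : 'I_n) : mmap h y 'X_k = y k.
Proof. by rewrite mmapX mmap1U. Qed.

Lemma eq_mmap (R : nzRingType) (E : comNzRingType) (h h' : R -> E)
    (y y' : 'I_n -> E) : h =1 h' -> y =1 y' -> mmap h y =1 mmap h' y'.
Proof.
move=> eh ey p; rewrite /mmap; apply: eq_bigr => m _; rewrite eh.
by rewrite (mmap1_eq _ ey).
Qed.

Lemma rmorph_mmap (R : comNzRingType) (E E' : comNzRingType)
    (h : {rmorphism R -> E}) (f : {rmorphism E -> E'}) (y : 'I_n -> E) p :
  f (mmap h y p) = mmap (f \o h) (f \o y) p.
Proof.
rewrite /mmap rmorph_sum; apply: eq_bigr => m _.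
by rewrite rmorphM /mmap1 rmorph_prod; under eq_bigr do rewrite rmorphXn.
Qed.

Lemma mmap_id (R : comNzRingType) (p : {mpoly R[n]}) :
  mmap (@mpolyC n R) (fun k => 'X_k) p = p.
Proof.
rewrite /mmap [RHS]mpolyE; apply: eq_bigr => m _.
by rewrite mul_mpolyC mmap1_id.
Qed.

Lemma mmap_morph (R E : comNzRingType) (f : {rmorphism {mpoly R[n]} -> E}) p :
  f p = mmap (f \o @mpolyC n R) (fun k => f 'X_k) p.
Proof. by rewrite -[in LHS](mmap_id p) rmorph_mmap. Qed.

Lemma mmap_set_coord (R : nzRingType) (E : comNzRingType) (h : R -> E)
    (y : 'I_n -> E) (i : 'I_n) v (p : {mpoly R[n]}) :
  (forall m, m \in msupp p -> m i = 0%N) ->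
  mmap h (set_coord y i v) p = mmap h y p.
Proof.
move=> pi; rewrite /mmap big_seq [RHS]big_seq; apply: eq_bigr => m /pi mi.
congr (_ * _); apply: eq_bigr => k _; rewrite /set_coord; case: eqP => // ->.
by rewrite mi !expr0.
Qed.

Lemma involvesPn (R : idomainType) (p : {mpoly R[n]}) (i : 'I_n) :
  reflect (forall m, m \in msupp p -> m i = 0%N) (~~ involves p i).
Proof.
rewrite /involves -all_predC.
by apply: (iffP allP) => H m /H /=; rewrite ?negbK => /eqP.
Qed.

End MmapFacts.

Lemma mnm_addU_ind (n : nat) (P : 'X_{1..n} -> Prop) :
  P 0%MM -> (forall c k, P c -> P (U_(k) + c)%MM) -> forall c, P c.
Proof.
move=> P0 PU c; move: {2}(mdeg c) (erefl (mdeg c)) => d.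
elim: d c => [|d IH] c dc; first by move/eqP: dc; rewrite mdeg_eq0 => /eqP ->.
have [k ck] : exists k, c k != 0%N.
  apply/existsP; rewrite -negb_forall; apply/negP => /forallP c0.
  by move: dc; rewrite mdegE big1 // => k _; apply/eqP.
have ec : (U_(k) + (c - U_(k)))%MM = c.
  rewrite addmC submK //; apply/mnm_lepP => i; rewrite mnm1E.
  by case: eqP => [<-|//]; rewrite lt0n.
by rewrite -ec; apply/PU/IH; move: dc; rewrite -{1}ec mdegD mdeg1 => -[].
Qed.

Section PrimeVariables.
Variables (R : idomainType) (n : nat).
Implicit Types p q f : {mpoly R[n]}.

Lemma dvdX_support p (k : 'I_n) :
  (forall m, m \in msupp p -> m k != 0%N) -> divides 'X_k p.
Proof.
move=> hp; exists (\sum_(m <- msupp p) p@_m *: 'X_[m - U_(k)]).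
rewrite [LHS]mpolyE mulr_suml [LHS]big_seq [RHS]big_seq; apply: eq_bigr => m mp.
rewrite -scalerAl -mpolyXD submK //; apply/mnm_lepP => i; rewrite mnm1E.
by case: eqP => [<-|//]; rewrite lt0n hp.
Qed.

(** The variables of a polynomial ring over a domain are prime: the evaluation
    at 0 of one of them is a ring morphism to a domain, whose kernel is the
    ideal generated by that variable. *)
Lemma dvdX_mul p q (k : 'I_n) :
  divides 'X_k (p * q) -> divides 'X_k p \/ divides 'X_k q.
Proof.
pose ev := mmap (@mpolyC n R) (set_coord (fun i => 'X_i) k (0 : {mpoly R[n]})).
have ker r : ev r = 0 -> divides 'X_k r.
  move=> ev0; apply: dvdX_support => m mr; apply/negP => /eqP mk.
  move: mr; rewrite mcoeff_msupp => /negP; apply; apply/eqP.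
  move/(congr1 (mcoeff m)): ev0; rewrite mcoeff0 => <-.
  rewrite [in RHS]/ev /mmap raddf_sum /= {1}[r]mpolyE raddf_sum /=.
  apply: eq_bigr => m' _; rewrite mcoeffZ mcoeffCM; congr (_ * _).
  have [m'k|m'k] := eqVneq (m' k) 0%N; last first.
    rewrite [mmap1 _ _](bigD1 k) //= /set_coord eqxx expr0n (negbTE m'k) mul0r.
    by rewrite mcoeff0 mcoeffX; case: eqP => // e; rewrite e mk in m'k.
  rewrite -mmap1_id; congr (_@_m); apply: eq_bigr => i _; rewrite /set_coord.
  by case: eqP => [->|//]; rewrite m'k !expr0.
case=> c /(congr1 ev); rewrite /ev !rmorphM /= mmapXU /set_coord eqxx mulr0.
by move/eqP; rewrite mulf_eq0 => /orP[] /eqP ?; [left|right]; apply: ker.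
Qed.

(** Unique factorisation as far as the variables are concerned: each variable
    of the monomial is cancelled in one of the two factors. *)
Lemma split_monomial (c : 'X_{1..n}) p q f : p * q = 'X_[c] * f ->
  exists a b p0 q0,
    [/\ (a + b)%MM = c, p = 'X_[a] * p0, q = 'X_[b] * q0 & p0 * q0 = f].
Proof.
elim/mnm_addU_ind: c p q f => [|c k IH] p q f.
  rewrite mpolyX0 mul1r => <-; exists 0%MM, 0%MM, p, q.
  by rewrite mpolyX0 !mul1r addm0.
move=> e; have : divides 'X_k (p * q).
  by exists ('X_[c] * f); rewrite e mpolyXD -mulrA mulrC -mulrA.
have X0 : 'X_[R, U_(k)] != 0 by rewrite mpolyX_neq0.
case/dvdX_mul => -[r er].
  have : r * q = 'X_[c] * f.
    apply: (mulIf X0); rewrite -mulrA [q * _]mulrC mulrA -er e mpolyXD; ring.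
  case/IH => a [b [p0 [q0 [<- r0 -> <-]]]].
  exists (U_(k) + a)%MM, b, p0, q0; split=> //; first by rewrite addmA.
  by rewrite er r0 mpolyXD; ring.
have : p * r = 'X_[c] * f.
  by apply: (mulIf X0); rewrite -mulrA -er e mpolyXD; ring.
case/IH => a [b [p0 [q0 [<- -> r0 <-]]]].
exists a, (U_(k) + b)%MM, p0, q0; split=> //.
  by rewrite !addmA [(a + _)%MM]addmC.
by rewrite er r0 mpolyXD; ring.
Qed.

End PrimeVariables.

Section LaurentRing.
Variables (R : idomainType) (n : nat).
Local Notation L := (laurent R n).

Lemma lpoly_is_zmod_morphism : zmod_morphism (@lpoly R n).
Proof. by move=> p q; apply: val_inj; rewrite rmorphB /= tofracB. Qed.
Lemma lpoly_is_monoid_morphism : monoid_morphism (@lpoly R n).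
Proof.
split=> [|p q]; apply: val_inj; first by rewrite rmorph1 /= tofrac1.
by rewrite rmorphM /= tofracM.
Qed.
HB.instance Definition _ :=
  GRing.isZmodMorphism.Build _ _ (@lpoly R n) lpoly_is_zmod_morphism.
HB.instance Definition _ :=
  GRing.isMonoidMorphism.Build _ _ (@lpoly R n) lpoly_is_monoid_morphism.

Lemma lconst_is_zmod_morphism : zmod_morphism (@lconst R n).
Proof. by move=> c d; rewrite /lconst !rmorphB. Qed.
Lemma lconst_is_monoid_morphism : monoid_morphism (@lconst R n).
Proof. by split=> [|c d]; rewrite /lconst ?rmorph1 ?rmorphM. Qed.
HB.instance Definition _ :=
  GRing.isZmodMorphism.Build _ _ (@lconst R n) lconst_is_zmod_morphism.
HB.instance Definition _ :=
  GRing.isMonoidMorphism.Build _ _ (@lconst R n) lconst_is_monoid_morphism.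

Lemma lpoly_inj : injective (@lpoly R n).
Proof. by move=> p q /(congr1 val) /= /eqP; rewrite tofrac_eq => /eqP. Qed.

Lemma mmap_lpoly p : mmap (@lconst R n) (@lvar R n) p = lpoly p.
Proof. by rewrite [RHS](mmap_morph (@lpoly R n)). Qed.

Lemma lmon_unit (a : 'X_{1..n}) : lpoly 'X_[R, a] \is a GRing.unit.
Proof.
have aL : (('X_[R, a])%:F)^-1 \in @laurent_pred R n.
  by apply/laurent_predP; exists a, 1; rewrite tofrac1 div1r.
apply/unitrPr; exists (Laurent aL); apply: val_inj.
by rewrite rmorphM rmorph1 /= mulfV // tofrac_mpolyX_neq0.
Qed.

Lemma lvar_unit (k : 'I_n) : lvar R k \is a GRing.unit.
Proof. exact: lmon_unit. Qed.

Lemma laurentE (z : L) : exists a p, z = lpoly p / lpoly 'X_[a].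
Proof.
case: (laurent_predP _ (valP z)) => a [p e]; exists a, p.
apply: (mulIr (lmon_unit a)); rewrite divrK ?lmon_unit //.
move: e => /= e; apply: val_inj.
by rewrite rmorphM /= e divfK // tofrac_mpolyX_neq0.
Qed.

(** A polynomial which is a unit among Laurent polynomials divides a monomial,
    and [split_monomial] applies. *)
Lemma lpoly_unit (p : {mpoly R[n]}) : lpoly p \is a GRing.unit ->
  (forall k, ~ divides 'X_k p) -> p \is a GRing.unit.
Proof.
move=> /unitrPr[c]; have [a [q ->]] := laurentE c => e ndiv.
have : p * q = 'X_[a] * 1.
  apply: lpoly_inj; rewrite mulr1 rmorphM -[RHS]mul1r -e -!mulrA.
  rewrite mulVr ?mulr1 //.
  exact: lmon_unit.
case/split_monomial => b [d [p0 [q0 [_ ep _ pq]]]].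
have b0 : b = 0%MM.
  apply/mnmP => k; rewrite mnm0E; apply/eqP/negP => /negP bk.
  apply: (ndiv k); rewrite ep; exists ('X_[b - U_(k)] * p0).
  rewrite mulrAC -mpolyXD submK //; apply/mnm_lepP => i; rewrite mnm1E.
  by case: eqP => [<-|//]; rewrite lt0n.
by rewrite ep b0 mpolyX0 mul1r; apply/unitrPr; exists q0.
Qed.

(** Laurent polynomials are the localisation of the polynomials at the
    variables. *)
Lemma laurent_lift (E : comUnitRingType) (h : {rmorphism R -> E})
    (y : 'I_n -> E) : (forall k, y k \is a GRing.unit) ->
  exists f : {rmorphism L -> E},
    (forall c, f (lconst n c) = h c) /\ (forall k, f (lvar R k) = y k).
Proof.
move=> yU.
have XU a : mmap h y 'X_[R, a] \is a GRing.unit.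
  rewrite mmapX; apply: rpred_prod => i _; exact/rpredX/yU.
pose P (z : L) (w : E) :=
  exists a p, z = lpoly p / lpoly 'X_[a] /\ w = mmap h y p / mmap h y 'X_[a].
have Puniq z w w' : P z w -> P z w' -> w = w'.
  move=> [a [p [-> ->]]] [b [q [e ->]]].
  have e1 : p * 'X_[b] = q * 'X_[a].
    apply: lpoly_inj; rewrite !rmorphM /=.
    by rewrite -[lpoly p](divrK (lmon_unit a)) e mulrAC divrK ?lmon_unit.
  apply: (mulIr (XU a)); apply: (mulIr (XU b)); rewrite divrK //.
  by rewrite -rmorphM e1 rmorphM mulrAC divrK.
(* The value does not depend on the presentation of z as a fraction. *)
pose f z : E := sval (boolp.cid (let: ex_intro a (ex_intro p e) := laurentE z in
  ex_intro (P z) _ (ex_intro _ a (ex_intro _ p (conj e (erefl _)))))).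
have fP z : P z (f z) by rewrite /f; case: (boolp.cid _).
have fE z w : P z w -> f z = w by apply: Puniq; exact: fP.
have fB : zmod_morphism f.
  move=> z w; apply: fE.
  have [a [p [-> ->]]] := fP z; have [b [q [-> ->]]] := fP w.
  exists (a + b)%MM, (p * 'X_[b] - q * 'X_[a]).
  rewrite mpolyXD !rmorphB !rmorphM /=.
  rewrite !invrM ?lmon_unit // !mulrBl.
  split; congr (_ - _).
  - by rewrite -!mulrA; congr (_ * _); rewrite mulrA mulrV ?lmon_unit ?mul1r.
  - by rewrite -!mulrA; congr (_ * _); rewrite mulrCA mulrV ?lmon_unit ?mulr1.
  - by rewrite -!mulrA; congr (_ * _); rewrite mulrA mulrV ?mul1r.
  - by rewrite -!mulrA; congr (_ * _); rewrite mulrCA mulrV ?mulr1.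
have fM : monoid_morphism f.
  split=> [|z w]; apply: fE.
    exists 0%MM, 1; rewrite mpolyX0 !rmorph1 /=.
    by rewrite !divr1.
  have [a [p [-> ->]]] := fP z; have [b [q [-> ->]]] := fP w.
  exists (a + b)%MM, (p * q); rewrite mpolyXD !rmorphM /=.
  rewrite !invrM ?lmon_unit //.
  by split; rewrite mulrACA; congr (_ * _); rewrite mulrC.
pose fz := GRing.isZmodMorphism.Build _ _ f fB.
pose fm := GRing.isMonoidMorphism.Build _ _ f fM.
pose F : {rmorphism L -> E} := HB.pack f fz fm.
exists F; split=> [c|k]; apply: fE.
  by exists 0%MM, c%:MP; rewrite mpolyX0 !rmorph1 !divr1 mmapC.
by exists 0%MM, 'X_k; rewrite mpolyX0 !rmorph1 !divr1 mmapXU.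
Qed.

Lemma laurent_ext (E : comUnitRingType) (f g : {rmorphism L -> E}) :
  (forall c, f (lconst n c) = g (lconst n c)) ->
  (forall k, f (lvar R k) = g (lvar R k)) -> f =1 g.
Proof.
move=> ec ev z; have [a [p ->]] := laurentE z.
have fgp (q : {mpoly R[n]}) : f (lpoly q) = g (lpoly q).
  by rewrite -mmap_lpoly !rmorph_mmap; apply: eq_mmap.
by rewrite !rmorphM !rmorphV ?lmon_unit //= !fgp.
Qed.

End LaurentRing.

(** * Laurent monomials and exchange polynomials *)

(** 1 + T cannot be factored properly over D[T, T^-1]: up to powers of T the
    factors are polynomials in T, and their degrees add up to 1. *)
Lemma one_plus_T_factor (D : idomainType) (u p q : laurent D 1) :
  u \is a GRing.unit -> p * q = u * (1 + lvar D ord0) ->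
  p \is a GRing.unit \/ q \is a GRing.unit.
Proof.
move=> uU; suff base : forall p1 : laurent D 1, p1 * q = 1 + lvar D ord0 ->
    p1 \is a GRing.unit \/ q \is a GRing.unit.
  move=> e; case: (base (u^-1 * p)); rewrite ?unitrM ?unitrV ?uU.
  - by rewrite -mulrA e mulKr.
  - by left.
  - by right.
move=> p1; have [a [p' ->]] := laurentE p1; have [b [q' ->]] := laurentE q.
move=> e; have : p' * q' = 'X_[a + b] * (1 + 'X_ord0).
  apply: lpoly_inj; rewrite mpolyXD !rmorphM rmorphD rmorph1 /= -e.
  rewrite -[in LHS](divrK (lmon_unit _ a) (lpoly p')).
  rewrite -[in LHS](divrK (lmon_unit _ b) (lpoly q')).
  by rewrite [LHS]mulrACA [LHS]mulrC.
case/split_monomial => c [d [p0 [q0 [_ -> -> pq]]]].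
have sz1 : (msize (1 + 'X_ord0 : {mpoly D[1]}) <= 2)%N.
  by rewrite (leq_trans (msizeD_le _ _)) // msize1 msizeX mdeg1.
have nz : p0 * q0 != 0.
  rewrite pq; apply/eqP => /(congr1 (mcoeff 0%MM)).
  rewrite mcoeffD mcoeff1 eqxx mcoeffX mnm1_eq0 mcoeff0 addr0 => /eqP.
  by rewrite oner_eq0.
have cu (p2 : {mpoly D[1]}) k : p2 * k%:MP = 1 + 'X_ord0 ->
    lpoly k%:MP \is a GRing.unit.
  move=> /(congr1 (mcoeff 0%MM)).
  rewrite mulrC mcoeffCM mcoeffD mcoeff1 eqxx mcoeffX mnm1_eq0 addr0 => ek.
  by apply: rmorph_unit; apply: rmorph_unit; apply/unitrPr; exists p2@_0.
move: nz; rewrite mulf_eq0 negb_or => /andP[p0n q0n].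
move: sz1; rewrite -pq msizeM // => sz1.
have [sq|sp] : (msize q0 <= 1)%N \/ (msize p0 <= 1)%N.
  by move: sz1 p0n q0n; rewrite -!msize_poly_eq0; lia.
- right; rewrite rmorphM /= !unitrM unitrV !lmon_unit !andbT.
  by rewrite (msize1_polyC sq) in pq *; exact: cu pq.
- left; rewrite rmorphM /= !unitrM unitrV !lmon_unit !andbT.
  by rewrite (msize1_polyC sp) in pq *; rewrite mulrC in pq; exact: cu pq.
Qed.

Section MonomialValue.
Variable N : nat.

(** Written z^v in the comments. *)
Definition zmon (E : unitRingType) (z : 'I_N -> E) (v : 'I_N -> int) : E :=
  \prod_k z k ^ v k.

Variable E : idomainType.
Implicit Types (z : 'I_N -> E) (v w : 'I_N -> int).

Lemma eq_zmon z z' v v' : z =1 z' -> v =1 v' -> zmon z v = zmon z' v'.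
Proof. by move=> ez ev; apply: eq_bigr => k _; rewrite ez ev. Qed.

Lemma zmon_unit z v : (forall k, z k \is a GRing.unit) ->
  zmon z v \is a GRing.unit.
Proof. by move=> zU; rewrite unitr_prod // => k _; exact: unitrXz. Qed.

Lemma zmonD z v w : (forall k, z k \is a GRing.unit) ->
  zmon z (fun k => v k + w k) = zmon z v * zmon z w.
Proof.
move=> zU; rewrite /zmon -big_split.
by apply: eq_bigr => k _; exact: exprzDr.
Qed.

Lemma zmonB z v w : (forall k, z k \is a GRing.unit) ->
  zmon z (fun k => v k - w k) = zmon z v / zmon z w.
Proof.
move=> zU; apply: (mulIr (zmon_unit w zU)).
rewrite divrK ?zmon_unit // -zmonD //.
by apply: eq_zmon => // k; rewrite subrK.
Qed.

Lemma zmonXz z v (c : int) : (forall k, z k \is a GRing.unit) ->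
  zmon z v ^ c = zmon z (fun k => v k * c).
Proof.
move=> zU; rewrite /zmon.
suff [] : (\prod_k z k ^ v k) \is a GRing.unit /\
  (\prod_k z k ^ v k) ^ c = \prod_k z k ^ (v k * c) by [].
apply: (big_rec2 (fun a b => a \is a GRing.unit /\ a ^ c = b)).
  by rewrite unitr1 exp1rz.
move=> k a b _ [aU <-].
by rewrite unitrM aU unitrXz // exprzMl ?unitrXz // exprz_exp.
Qed.

End MonomialValue.

(** By l . b = 1, the first factors of the coordinates contribute
    z^b / (z^b)^(l . b) = 1 and the second ones t^(l . b) = t. *)
Lemma zmon_twist (N : nat) (D E : idomainType) (h : {rmorphism D -> E})
    (z : 'I_N -> D) (t : E) (l b : 'I_N -> int) :
  (forall k, z k \is a GRing.unit) -> t \is a GRing.unit ->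
  \sum_k l k * b k = 1 ->
  zmon (fun k => h (z k * (zmon z b)^-1 ^ l k) * t ^ l k) b = t.
Proof.
move=> zU tU lb; set x := (zmon z b)^-1.
have xU : x \is a GRing.unit by rewrite unitrV zmon_unit.
have prod_row (R : idomainType) (y : R) : y \is a GRing.unit ->
    \prod_k (y ^ l k) ^ b k = y.
  move=> yU; under eq_bigr => k _ do rewrite exprz_exp.
  by rewrite -(big_morph _ (exprzDr yU) (expr0z y)) lb expr1z.
have -> : zmon (fun k => h (z k * x ^ l k) * t ^ l k) b
    = \prod_k (h (z k ^ b k * (x ^ l k) ^ b k) * (t ^ l k) ^ b k).
  apply: eq_bigr => k _; rewrite -exprzMl ?unitrXz // rmorphXz; last first.
    by rewrite unitrM zU unitrXz.
  by rewrite -exprzMl ?unitrXz // rmorph_unit // unitrM zU unitrXz.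
rewrite big_split /= prod_row // -rmorph_prod big_split /= prod_row //.
by rewrite divrr ?zmon_unit // rmorph1 mul1r.
Qed.

(** A matrix with an integral left inverse M defines a surjection of tori with
    a section: the monomials whose exponents are the rows of M give a point at
    which the monomials of the columns of B take prescribed values. *)
Lemma zmon_section (N n : nat) (E : idomainType) (M : 'M[int]_(n, N))
    (B : 'M[int]_(N, n)) (t : 'I_n -> E) (j : 'I_n) :
  (forall l, t l \is a GRing.unit) -> M *m B = 1%:M ->
  zmon (fun k => zmon t (fun l => M l k)) (fun k => B k j) = t j.
Proof.
move=> tU MB; rewrite /zmon.
under eq_bigr => k _ do rewrite -/(zmon t _) zmonXz // /zmon.
rewrite exchange_big (bigD1 j) //= [X in _ * X]big1 => [|l lj].
  rewrite mulr1 -(big_morph _ (exprzDr (tU j)) (expr0z (t j))).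
  suff -> : \sum_i M j i * B i j = 1 by rewrite expr1z.
  by move/matrixP/(_ j j): MB; rewrite !mxE eqxx.
rewrite -(big_morph _ (exprzDr (tU l)) (expr0z (t l))).
suff -> : \sum_i M l i * B i j = 0 by rewrite expr0z.
by move/matrixP/(_ l j): MB; rewrite !mxE (negbTE lj).
Qed.

(** The positive part [b]_+ of an integer. *)
Definition posn (b : int) : nat := if 0 < b then `|b|%N else 0%N.

Lemma posnB (b : int) : (posn b)%:Z - (posn (- b))%:Z = b.
Proof. by rewrite /posn oppr_gt0; case: ltgtP; lia. Qed.

Section Exchange.
Variables (n r : nat).
Local Notation S := (laurent int r).
Local Notation L := (laurent S n).
Implicit Types (B : 'M[int]_(n + r, n)) (i j : 'I_n) (k : 'I_(n + r)).

(** The coordinates z_k, mutable and frozen, of a torus: the morphisms from the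
    ring of Laurent polynomials to E are the choices of n + r units of E, by
    [torus_lift] and [torus_ext]. *)
Definition torus_var k : L := lpoly (extended_var k).

Lemma extended_varl i : extended_var (lshift r i) = 'X_i.
Proof.
rewrite /extended_var; case: split_ordP => [l /lshift_inj -> //|l /eqP].
by rewrite eq_lrshift.
Qed.

Lemma extended_varr (f : 'I_r) :
  extended_var (rshift n f) = (lvar int f)%:MP.
Proof.
rewrite /extended_var; case: split_ordP => [l /eqP|l /rshift_inj -> //].
by rewrite eq_rlshift.
Qed.

Lemma torus_var_unit k : torus_var k \is a GRing.unit.
Proof.
rewrite /torus_var /extended_var; case: split => [i|f]; first exact: lmon_unit.
by apply: rmorph_unit; apply: rmorph_unit; exact: lvar_unit.
Qed.

Lemma torus_lift (E : comUnitRingType) (w : 'I_(n + r) -> E) :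
  (forall k, w k \is a GRing.unit) ->
  exists f : {rmorphism L -> E}, forall k, f (torus_var k) = w k.
Proof.
move=> wU; have [h [_ hv]] :=
  laurent_lift (intr : {rmorphism int -> E}) (fun f => wU (rshift n f)).
have [f [fc fv]] := laurent_lift h (fun i => wU (lshift r i)).
exists f => k; rewrite /torus_var.
case: (split_ordP k) => [i ->|l ->]; first by rewrite extended_varl fv.
by rewrite extended_varr fc hv.
Qed.

Lemma torus_ext (E : comUnitRingType) (f g : {rmorphism L -> E}) :
  (forall k, f (torus_var k) = g (torus_var k)) -> f =1 g.
Proof.
move=> e; apply: laurent_ext => [c|i]; last first.
  by have := e (lshift r i); rewrite /torus_var extended_varl.
pose f' : {rmorphism S -> E} := f \o @lconst S n.
pose g' : {rmorphism S -> E} := g \o @lconst S n.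
suff : f' =1 g' by apply.
apply: laurent_ext => [d|l].
  by rewrite -[d]intz !rmorph_int.
by have := e (rshift n l); rewrite /torus_var extended_varr.
Qed.

Lemma exchange_polyE B j : exchange_poly B j =
  \prod_k extended_var k ^+ posn (B k j) +
  \prod_k extended_var k ^+ posn (- B k j).
Proof.
rewrite /exchange_poly /posn; congr (_ + _); rewrite big_mkcond;
  apply: eq_bigr => k _; rewrite ?oppr_gt0; case: ifP => //.
by rewrite abszN.
Qed.

Lemma rmorph_exchange (E : comNzRingType)
    (f : {rmorphism {mpoly S[n]} -> E}) B j :
  f (exchange_poly B j) =
  \prod_k f (extended_var k) ^+ posn (B k j) +
  \prod_k f (extended_var k) ^+ posn (- B k j).
Proof.
rewrite exchange_polyE rmorphD !rmorph_prod.
by congr (_ + _); apply: eq_bigr => k _; rewrite rmorphXn.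
Qed.

(** F_j is the unit z^[-b]_+ times 1 + z^b, where b is the j-th column. *)
Lemma torus_exchange (E : idomainType) (f : {rmorphism {mpoly S[n]} -> E}) B j :
  (forall k, f (extended_var k) \is a GRing.unit) ->
  f (exchange_poly B j) =
    zmon (f \o @extended_var n r) (fun k => posn (- B k j)) *
      (1 + zmon (f \o @extended_var n r) (fun k => B k j)).
Proof.
move=> fU; rewrite rmorph_exchange mulrDr mulr1 addrC; congr (_ + _).
rewrite -zmonD //; apply: eq_bigr => k _.
by rewrite -{3}[B k j]posnB addrC subrK.
Qed.

(** An integral left inverse of B allows one to prescribe the values of z^b for
    all columns b of B independently.  A value -1 makes the exchange polynomial
    vanish, any other value keeps it nonzero. *)
Lemma exchange_point B (M : 'M[int]_(n, n + r)) (t : 'I_n -> rat) :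
  M *m B = 1%:M -> (forall l, t l != 0) ->
  exists f : {rmorphism L -> rat}, forall j, exists2 u : rat, u != 0 &
    f (lpoly (exchange_poly B j)) = u * (1 + t j).
Proof.
move=> MB t0; have tU l : t l \is a GRing.unit by rewrite unitfE.
have [f fv] := torus_lift (fun k => zmon_unit (fun l => M l k) tU).
pose g : {rmorphism {mpoly S[n]} -> rat} := f \o @lpoly S n.
have gU k : g (extended_var k) \is a GRing.unit.
  by rewrite /= fv zmon_unit.
exists f => j; exists (zmon (g \o @extended_var n r) (fun k => posn (- B k j))).
  by rewrite -unitfE zmon_unit.
rewrite -[LHS]/(g _) torus_exchange //; congr (_ * (1 + _)).
by rewrite -(zmon_section j tU MB); apply: eq_zmon => // k; rewrite /= fv.
Qed.

(** Setting all variables to 1 counts the monomials of F_j; setting X_i to 0 as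
    well counts those without X_i. *)
Lemma exchange_at0 (h : {rmorphism S -> rat}) B i j :
  (forall f, h (lvar int f) = 1) ->
  (mmap h (set_coord (fun=> 1) i 0) (exchange_poly B j)
     = if B (lshift r i) j == 0 then 2 else 1) /\
  mmap h (fun=> 1) (exchange_poly B j) = 2.
Proof.
move=> h1; split; rewrite (rmorph_exchange (mmap h _)); last first.
  rewrite !big1 // => k _; case: (split_ordP k) => [l ->|l ->];
    by rewrite /= ?extended_varl ?extended_varr ?mmapXU ?mmapC /= ?h1 expr1n.
have val0 (e : 'I_(n + r) -> nat) :
    \prod_k mmap h (set_coord (fun=> 1) i 0) (extended_var k) ^+ e k
    = (e (lshift r i) == 0%N)%:R.
  rewrite (bigD1 (lshift r i)) //= extended_varl mmapXU /set_coord eqxx expr0n.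
  rewrite big1 ?mulr1 // => k ki.
  case: (split_ordP k) => [l el|l ->]; last first.
    by rewrite extended_varr mmapC /= h1 expr1n.
  rewrite el extended_varl mmapXU; case: eqP => [eli|_]; last by rewrite expr1n.
  by rewrite el eli eqxx in ki.
rewrite !val0 /posn; case: (ltgtP (B (lshift r i) j) 0) => b0.
- by rewrite oppr_gt0 b0 /= abszN absz_eq0 lt_eqF.
- by rewrite oppr_gt0 ltNge (ltW b0) /= absz_eq0 gt_eqF.
- by rewrite b0 oppr0 ltxx eqxx.
Qed.

Lemma S_to_one : exists h : {rmorphism S -> rat}, forall f, h (lvar int f) = 1.
Proof.
have U1 (f : 'I_r) : (1 : rat) \is a GRing.unit by exact: unitr1.
by have [h [_ ?]] := laurent_lift (intr : {rmorphism int -> rat}) U1; exists h.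
Qed.

(** No variable occurs in both monomials of F_j. *)
Lemma exchange_ndvdX B i j : ~ divides 'X_i (exchange_poly B j).
Proof.
have [h h1] := S_to_one; case: (exchange_at0 B i j h1) => e _.
case=> c /(congr1 (mmap h (set_coord (fun=> 1) i 0))).
rewrite e rmorphM /= mmapXU /set_coord eqxx mulr0; by case: ifP.
Qed.

Lemma exchange_involves B i j :
  involves (exchange_poly B j) i = (B (lshift r i) j != 0).
Proof.
apply/idP/idP => [|b0].
  apply: contraTN => /eqP b0; apply/involvesPn => m.
  pose C (p : {mpoly S[n]}) := forall m, m \in msupp p -> m i = 0%N.
  have C1 : C 1 by move=> m'; rewrite msupp1 inE => /eqP ->; rewrite mnm0E.
  have CM p q : C p -> C q -> C (p * q).
    move=> Cp Cq m' /msuppM_le /allpairsP[[a b] /= [/Cp ea /Cq eb ->]].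
    by rewrite mnmDE ea eb.
  have CP (e : 'I_(n + r) -> nat) : e (lshift r i) = 0%N ->
      C (\prod_k extended_var k ^+ e k).
    move=> e0; apply: (big_ind C) => // k _.
    have [->|ki] := eqVneq k (lshift r i); first by rewrite e0 expr0.
    elim: (e k) => [|d IH]; rewrite ?expr0 ?exprS //; apply: CM => //.
    case: (split_ordP k) => [l el|l ->]; last first.
      rewrite extended_varr => m'; rewrite msuppC; case: ifP => // _.
      by rewrite inE => /eqP ->; rewrite mnm0E.
    rewrite el extended_varl => m'; rewrite msuppX inE => /eqP ->.
    rewrite mnm1E.
    by case: eqP => // eli; rewrite el eli eqxx in ki.
  rewrite exchange_polyE => /msuppD_le; rewrite mem_cat => /orP[] mp.
    by apply: CP mp; rewrite b0.
  by apply: CP mp; rewrite b0.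
have [h h1] := S_to_one; case: (exchange_at0 B i j h1).
rewrite (negbTE b0) => e0 e1; apply/negPn/negP => /involvesPn inv.
by move: e0; rewrite mmap_set_coord // e1.
Qed.

(** Choose l in Z^(n+r) with l . b = 1, where b is the j-th column.  The ring of
    Laurent polynomials embeds into its ring of Laurent polynomials in T by
    z^u |-> z^(u - (l . u) b) T^(l . u), with left inverse T |-> z^b.  The
    exchange polynomial becomes a unit times 1 + T, and a left inverse maps
    units to units. *)
Lemma exchange_irreducible B (M : 'M[int]_(n, n + r)) j :
  M *m B = 1%:M -> irreducible (exchange_poly B j).
Proof.
move=> MB; split.
- have [f /(_ j) [u u0 e]] := exchange_point (t := fun=> 1) MB (fun=> isT).
  apply/eqP => F0; move: e; rewrite F0 !rmorph0 => /esym/eqP.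
  by rewrite mulf_eq0 (negbTE u0).
- have [f /(_ j) [u u0 e]] := exchange_point (t := fun=> -1) MB (fun=> isT).
  apply/negP => FU; have := rmorph_unit f (rmorph_unit (@lpoly S n) FU).
  by rewrite /= e subrr mulr0 unitr0.
move=> P Q ePQ.
pose zb := zmon torus_var (fun k => B k j).
have zbU : zb \is a GRing.unit by apply: zmon_unit; exact: torus_var_unit.
pose T := lvar L (ord0 : 'I_1).
have TU : T \is a GRing.unit by exact: lvar_unit.
pose v k := torus_var k * zb^-1 ^ M j k.
have vU k : v k \is a GRing.unit.
  by rewrite unitrM torus_var_unit unitrXz // unitrV.
pose w k : laurent L 1 := lconst 1 (v k) * T ^ M j k.
have wU k : w k \is a GRing.unit.
  by rewrite unitrM unitrXz // andbT; exact: rmorph_unit.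
have [phi phiv] := torus_lift wU.
have [psi [psic psiT]] :=
  laurent_lift (idfun : {rmorphism L -> L}) (fun _ : 'I_1 => zbU).
have psiphi x : psi (phi x) = x.
  apply: (@torus_ext _ (psi \o phi) idfun) => k /=.
  rewrite phiv /w rmorphM rmorphXz //= psic psiT /= /v exprz_inv -invr_expz.
  by rewrite divrK // unitrXz.
pose g : {rmorphism {mpoly S[n]} -> laurent L 1} := phi \o @lpoly S n.
have gU k : g (extended_var k) \is a GRing.unit.
  by rewrite -[g _]/(phi (torus_var k)) phiv.
have gT : zmon (g \o @extended_var n r) (fun k => B k j) = T.
  transitivity (zmon w (fun k => B k j)); first exact: eq_zmon phiv _.
  apply: zmon_twist => //; first exact: torus_var_unit.
  by move/matrixP/(_ j j): MB; rewrite !mxE eqxx.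
have : g P * g Q =
    zmon (g \o @extended_var n r) (fun k => posn (- B k j)) * (1 + T).
  by rewrite -rmorphM -ePQ torus_exchange // gT.
have backU (R : {mpoly S[n]}) : (forall k : 'I_n, ~ divides 'X_k R) ->
    g R \is a GRing.unit -> R \is a GRing.unit.
  move=> ndR gRU; apply: lpoly_unit => //.
  by rewrite -[lpoly R]psiphi; exact: rmorph_unit.
case/one_plus_T_factor; first exact: zmon_unit.
- left; apply: backU => // k [c ec]; apply: (@exchange_ndvdX B k j).
  by exists (c * Q); rewrite ePQ ec mulrAC.
- right; apply: backU => // k [c ec]; apply: (@exchange_ndvdX B k j).
  by exists (P * c); rewrite ePQ ec mulrA.
Qed.

End Exchange.

(** * Transcendence bases under an exchange *)

Lemma divKf (E : fieldType) (a b : E) : a != 0 -> a / (a / b) = b.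
Proof. by move=> a0; rewrite invf_div mulrCA divff ?mulr1. Qed.

Section Fractions.
Variables (A : nzRingType) (E : fieldType) (f : {rmorphism A -> E}).

(** For f the evaluation at a cluster, this is the field that it generates. *)
Definition fractions (z : E) : Prop :=
  exists p q : A, f q != 0 /\ z = f p / f q.

Lemma fractionsD z w : fractions z -> fractions w -> fractions (z + w).
Proof.
move=> [p [q [q0 ->]]] [p' [q' [q0' ->]]]; exists (p * q' + p' * q), (q * q').
by rewrite rmorphD !rmorphM mulf_neq0 // addf_div.
Qed.

Lemma fractionsM z w : fractions z -> fractions w -> fractions (z * w).
Proof.
move=> [p [q [q0 ->]]] [p' [q' [q0' ->]]]; exists (p * p'), (q * q').
by rewrite !rmorphM mulf_neq0 // mulf_div.
Qed.

Lemma fractionsV z : fractions z -> fractions z^-1.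
Proof.
move=> [p [q [q0 ->]]]; have [p0|p0] := eqVneq (f p) 0.
  by exists 0, 1; rewrite rmorph1 rmorph0 oner_eq0 p0 !mul0r invr0.
by exists q, p; rewrite invf_div.
Qed.

End Fractions.

(** Substitute F / X_i for X_i in p and clear the denominator.  The same q and N
    serve for all fields E, so that a relation between elements of one field can
    be transported to the generic point. *)
Lemma clear_denominator (R : comNzRingType) (n : nat) (i : 'I_n)
    (F p : {mpoly R[n]}) :
  exists q N, forall (E : fieldType) (h : {rmorphism R -> E}) (y : 'I_n -> E),
    y i != 0 ->
    mmap h y q = mmap h (set_coord y i (mmap h y F / y i)) p * y i ^+ N.
Proof.
elim/mpolyind: p => [|c m p _ _ [q [N qP]]].
  by exists 0, 0%N => E h y _; rewrite !rmorph0 mul0r.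
(* The i-th factor of the monomial becomes F^(m i) / X_i^(m i). *)
exists (c *: ((\prod_(k | k != i) 'X_k ^+ m k) * F ^+ m i) * 'X_i ^+ N
        + q * 'X_i ^+ m i), (m i + N)%N => E h y yi.
rewrite !rmorphD !rmorphM /= !mmapZ !rmorphM !rmorphXn /= qP // !mmapXU mmapX.
rewrite mulrDl exprD; congr (_ + _); last by rewrite mulrA mulrAC.
rewrite -!mulrA; congr (_ * _).
rewrite /mmap1 [X in _ = X * _](bigD1 i) //= {1}/set_coord eqxx.
rewrite rmorph_prod; have -> : \prod_(k | k != i) mmap h y ('X_k ^+ m k) =
    \prod_(k | k != i) set_coord y i (mmap h y F / y i) k ^+ m k.
  by apply: eq_bigr => k ki; rewrite rmorphXn /= mmapXU /set_coord (negbTE ki).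
rewrite expr_div_n !mulrA; congr (_ * _).
by rewrite [RHS]mulrAC divfK ?expf_neq0 // mulrC.
Qed.

Section Ambient.
Variables (S : idomainType) (n : nat).
Local Notation K := (ambient S n).
Implicit Types (x : 'I_n -> K) (F p : {mpoly {fraction S}[n]}).

Lemma of_fracS_is_zmod_morphism : zmod_morphism (@of_fracS S n).
Proof. by move=> c d; rewrite /of_fracS !rmorphB. Qed.
Lemma of_fracS_is_monoid_morphism : monoid_morphism (@of_fracS S n).
Proof. by split=> [|c d]; rewrite /of_fracS ?rmorph1 ?rmorphM. Qed.
HB.instance Definition _ :=
  GRing.isZmodMorphism.Build _ _ (@of_fracS S n) of_fracS_is_zmod_morphism.
HB.instance Definition _ :=
  GRing.isMonoidMorphism.Build _ _ (@of_fracS S n) of_fracS_is_monoid_morphism.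

Lemma of_S_is_zmod_morphism : zmod_morphism (@of_S S n).
Proof. by move=> c d; rewrite /of_S !rmorphB. Qed.
Lemma of_S_is_monoid_morphism : monoid_morphism (@of_S S n).
Proof. by split=> [|c d]; rewrite /of_S ?rmorph1 ?rmorphM. Qed.
HB.instance Definition _ :=
  GRing.isZmodMorphism.Build _ _ (@of_S S n) of_S_is_zmod_morphism.
HB.instance Definition _ :=
  GRing.isMonoidMorphism.Build _ _ (@of_S S n) of_S_is_monoid_morphism.

Lemma mmap_generic p : mmap (@of_fracS S n) (fun k => ('X_k)%:F) p = p%:F.
Proof. by rewrite [RHS](mmap_morph (@tofrac {mpoly {fraction S}[n]})). Qed.

Lemma alg_independent_neq0 x i : alg_independent x -> x i != 0.
Proof.
move=> ax; apply/eqP => xi0.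
have /ax/eqP : mmap (@of_fracS S n) x 'X_i = 0 by rewrite mmapXU.
by rewrite (negbTE (mpolyX_neq0 _ _)).
Qed.

(** A polynomial relation between the new variables gives one between the old
    ones by clearing the denominator x_i.  That one is trivial, hence it stays
    so after substituting F / X_i for X_i, which, F not involving X_i, gives the
    relation we started from back. *)
Lemma alg_independent_mutation x i F : F != 0 ->
  (forall m, m \in msupp F -> m i = 0%N) -> alg_independent x ->
  alg_independent (set_coord x i (mmap (@of_fracS S n) x F / x i)).
Proof.
move=> F0 Fi ax p px0; have [q [N qP]] := clear_denominator i F p.
have q0 : q = 0.
  by apply: (ax); rewrite qP ?px0 ?mul0r //; exact: alg_independent_neq0.
pose X : 'I_n -> K := fun k => ('X_k)%:F.
have X0 k : X k != 0 by rewrite tofrac_eq0 mpolyX_neq0.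
pose y := set_coord X i (F%:F / X i).
have yi : y i = F%:F / X i by rewrite /y /set_coord eqxx.
have y0 : y i != 0 by rewrite yi mulf_neq0 ?invr_eq0 ?X0 // tofrac_eq0.
have := qP _ (@of_fracS S n) y y0; rewrite q0 rmorph0 => /esym/eqP.
rewrite mulf_eq0 (negbTE (expf_neq0 _ y0)) orbF.
have -> : mmap (@of_fracS S n) y F = F%:F.
  by rewrite mmap_set_coord // -mmap_generic.
rewrite (@eq_mmap _ _ _ _ (@of_fracS S n) _ X) // => [|k].
  by rewrite mmap_generic tofrac_eq0 => /eqP.
rewrite {1}/set_coord; case: eqP => [->|/eqP ki]; last first.
  by rewrite /y /set_coord (negbTE ki).
by rewrite yi; apply: divKf; rewrite tofrac_eq0.
Qed.

Section GeneratedField.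
Variable x : 'I_n -> K.
Local Notation ev := (mmap (@of_fracS S n) x).

Lemma in_gen_poly p : in_generated_field x (ev p).
Proof. by exists p, 1; rewrite rmorph1 oner_eq0 divr1. Qed.

Lemma in_genD z w : in_generated_field x z -> in_generated_field x w ->
  in_generated_field x (z + w).
Proof. move=> hz hw; exact: (fractionsD (f:=ev) hz hw). Qed.

Lemma in_genM z w : in_generated_field x z -> in_generated_field x w ->
  in_generated_field x (z * w).
Proof. move=> hz hw; exact: (fractionsM (f:=ev) hz hw). Qed.

Lemma in_genV z : in_generated_field x z -> in_generated_field x z^-1.
Proof. move=> hz; exact: (fractionsV (f:=ev) hz). Qed.

Lemma in_gen_sub (x' : 'I_n -> K) z :
  (forall k, in_generated_field x (x' k)) ->
  in_generated_field x' z -> in_generated_field x z.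
Proof.
move=> xx' [p [q [_ ->]]].
suff ip r : in_generated_field x (mmap (@of_fracS S n) x' r).
  exact/in_genM/in_genV.
elim/mpolyind: r => [|c m r _ _ IH].
  by rewrite rmorph0 -(rmorph0 ev); exact: in_gen_poly.
rewrite rmorphD; apply: in_genD => //=; rewrite mmapZ mmapX; apply: in_genM.
  by have := in_gen_poly c%:MP; rewrite mmapC.
apply: (big_ind (in_generated_field x)); [|exact: in_genM|move=> k _].
  by rewrite -(rmorph1 ev); exact: in_gen_poly.
elim: (m k) => [|d IHd]; last by rewrite exprS; exact: in_genM.
by rewrite expr0 -(rmorph1 ev); exact: in_gen_poly.
Qed.

End GeneratedField.

(** The mutation is an involution, since F does not involve X_i: the old
    variable is F / x_i', so that both clusters generate the same field. *)
Lemma transcendence_basis_mutation x i F : F != 0 ->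
  (forall m, m \in msupp F -> m i = 0%N) -> transcendence_basis x ->
  transcendence_basis (set_coord x i (mmap (@of_fracS S n) x F / x i)).
Proof.
move=> F0 Fi [ax cx]; split; first exact: alg_independent_mutation.
set x' := set_coord _ _ _.
have xi0 := alg_independent_neq0 i ax.
have Fx0 : mmap (@of_fracS S n) x F != 0 by apply: contraNneq F0 => /ax ->.
have x'k k : in_generated_field x' (x' k).
  by rewrite -(mmapXU (@of_fracS S n) x' k); exact: in_gen_poly.
have gx k : in_generated_field x' (x k).
  have [->|ki] := eqVneq k i; last first.
    by have := x'k k; rewrite {2}/x' /set_coord (negbTE ki).
  have -> : x i = mmap (@of_fracS S n) x' F / x' i.
    rewrite /x' mmap_set_coord // /set_coord eqxx.
    by rewrite divKf.
  by apply: in_genM; [exact: in_gen_poly | exact/in_genV/x'k].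
move=> z; have [P [P0 Pg Pz]] := cx z; exists P; split=> // k.
exact: in_gen_sub gx (Pg k).
Qed.

Lemma mmap_of_S x (p : {mpoly S[n]}) :
  mmap (@of_S S n) x p = mmap (@of_fracS S n) x (map_mpoly (@tofrac S) p).
Proof.
rewrite /map_mpoly rmorph_mmap; apply: eq_mmap => [c|k] /=.
  by rewrite mmapC.
by rewrite mmapXU.
Qed.

Lemma map_tofrac_inj : injective (map_mpoly (@tofrac S) : {mpoly S[n]} -> _).
Proof.
move=> p q e; apply/mpolyP => m; apply/eqP; rewrite -tofrac_eq.
by rewrite -!mcoeff_map_mpoly e.
Qed.

Lemma mmap_of_S_neq0 x (p : {mpoly S[n]}) : alg_independent x -> p != 0 ->
  mmap (@of_S S n) x p != 0.
Proof.
move=> ax; apply: contraNneq; rewrite mmap_of_S => /ax e.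
by rewrite -(inj_eq map_tofrac_inj) e rmorph0.
Qed.

Lemma transcendence_basis_exchange x i (F : {mpoly S[n]}) :
  F != 0 -> ~~ involves F i -> transcendence_basis x ->
  transcendence_basis (set_coord x i (mmap (@of_S S n) x F / x i)).
Proof.
move=> F0 /involvesPn Fi; rewrite mmap_of_S.
apply: transcendence_basis_mutation => [|m].
  by apply: contraNneq F0 => e; rewrite -(inj_eq map_tofrac_inj) e rmorph0.
rewrite mcoeff_msupp mcoeff_map_mpoly tofrac_eq0 -mcoeff_msupp; exact: Fi.
Qed.

End Ambient.

(** * Mutation of exchange matrices *)

Section MatrixMutation.
Variables (n r : nat).
Local Notation I i := (lshift r i).
Implicit Types (B : 'M[int]_(n + r, n)) (i j : 'I_n) (k : 'I_(n + r)).

Lemma normz_posn (a : int) : `|a| = (posn a)%:Z + (posn (- a))%:Z.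
Proof. by rewrite /posn oppr_gt0; case: ltgtP; lia. Qed.

(** The mutation rule in terms of positive parts; it shows that the numerator is
    even. *)
Lemma mutation_termE (a b : int) : ((`|a| * b + a * `|b|) %/ 2)%Z =
  (posn a)%:Z * (posn b)%:Z - (posn (- a))%:Z * (posn (- b))%:Z.
Proof.
rewrite !normz_posn -{1}[b]posnB -{3}[a]posnB.
set pa := (posn a)%:Z; set na := (posn (- a))%:Z.
set pb := (posn b)%:Z; set nb := (posn (- b))%:Z.
have -> : (pa + na) * (pb - nb) + (pa - na) * (pb + nb)
    = (pa * pb - na * nb) * 2 by ring.
by rewrite mulzK.
Qed.

Lemma posn_mul (a b : int) :
  (posn a)%:Z * (posn b)%:Z - (posn (- a))%:Z * (posn (- b))%:Z =
  (posn a)%:Z * b + a * (posn (- b))%:Z.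
Proof.
move: (posnB a) (posnB b).
move: (posn a) (posn (- a)) (posn b) (posn (- b)) => pa na pb nb <- <-; ring.
Qed.

Lemma matrix_mutationE i B k j : k != I i -> j != i ->
  matrix_mutation i B k j = B k j + ((posn (B k i))%:Z * (posn (B (I i) j))%:Z
     - (posn (- B k i))%:Z * (posn (- B (I i) j))%:Z).
Proof. by move=> ki ji; rewrite mxE (negbTE ki) (negbTE ji) mutation_termE. Qed.

Lemma matrix_mutation_row i B j : matrix_mutation i B (I i) j = - B (I i) j.
Proof. by rewrite mxE eqxx. Qed.

Lemma matrix_mutation_col i B k : matrix_mutation i B k i = - B k i.
Proof. by rewrite mxE eqxx orbT. Qed.

Lemma matrix_mutationK i : involutive (@matrix_mutation n r i).
Proof.
move=> B; apply/matrixP => k j.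
have [->|ki] := eqVneq k (I i); first by rewrite !matrix_mutation_row opprK.
have [->|ji] := eqVneq j i; first by rewrite !matrix_mutation_col opprK.
rewrite !(matrix_mutationE _ ki ji).
rewrite matrix_mutation_row matrix_mutation_col !opprK.
by ring.
Qed.

(** What LP seeds and LP mutations use of skew-symmetrizability; no symmetrizer
    is mentioned. *)
Definition sign_skew B : Prop :=
  (forall i, B (I i) i = 0) /\
  (forall i j, (0 < B (I i) j) = (B (I j) i < 0)).

Lemma skew_entries B : skew_symmetrizable (usubmx B) <->
  exists2 d : 'I_n -> rat, forall i, 0 < d i &
    forall i j, d i * (B (I i) j)%:~R = - (d j * (B (I j) i)%:~R).
Proof.
have ent (d : 'rV[rat]_n) i j :
    (diag_mx d *m map_mx intr (usubmx B)) i j = d 0 i * (B (I i) j)%:~R.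
  by rewrite mul_diag_mx !mxE.
split=> [[d [d0 e]]|[d d0 e]].
  exists (d 0) => // i j; move/matrixP/(_ j i): e.
  by rewrite mxE ent => ->; rewrite mxE ent.
exists (\row_i d i); split=> [i|]; first by rewrite mxE.
by apply/matrixP => i j; rewrite /= mxE [in RHS]mxE !ent !mxE e.
Qed.

Lemma skew_sign B : skew_symmetrizable (usubmx B) -> sign_skew B.
Proof.
case/skew_entries => d d0 e; split=> [i|i j].
  have := e i i => /eqP; rewrite -addr_eq0 -mulr2n mulrn_eq0 /=.
  by rewrite mulf_eq0 gt_eqF //= intr_eq0 => /eqP.
rewrite -(ltr0z rat) -(pmulr_rgt0 _ (d0 i)) e oppr_gt0.
by rewrite pmulr_rlt0 // ltrz0.
Qed.

Lemma skew_mutation i B :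
  skew_symmetrizable (usubmx B) ->
  skew_symmetrizable (usubmx (matrix_mutation i B)).
Proof.
move=> sk; have [B0 Bs] := skew_sign sk.
move: sk => /skew_entries[d d0 e]; apply/skew_entries; exists d => // k j.
have lE l l' : (I l == I l' :> 'I_(n + r)) = (l == l').
  by apply/eqP/eqP => [/lshift_inj|->].
have [->|ki] := eqVneq k i.
  by rewrite matrix_mutation_row matrix_mutation_col !rmorphN /= !mulrN e.
have [->|ji] := eqVneq j i.
  by rewrite matrix_mutation_row matrix_mutation_col !rmorphN /= !mulrN e.
rewrite !matrix_mutationE ?lE //.
have posE l l' :
    d l * (posn (B (I l) l'))%:~R = d l' * (posn (- B (I l') l))%:~R.
  rewrite /posn Bs oppr_gt0; case: ltP => Bn; last by rewrite !mulr0.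
  have := e l l'; have := Bs l l'; rewrite Bn => /esym yn.
  have -> : Posz `|B (I l) l'| = B (I l) l' by lia.
  have -> : Posz `|- B (I l') l| = - B (I l') l by lia.
  by move=> ->; rewrite rmorphN /= mulrN.
have pp a b c : d a * ((posn (B (I a) b))%:~R * (posn (B (I b) c))%:~R)
    = d c * ((posn (- B (I c) b))%:~R * (posn (- B (I b) a))%:~R).
  by rewrite mulrA posE mulrAC posE mulrA.
rewrite !rmorphD !rmorphN !rmorphM /= !mulrDr !mulrN e pp -(pp j i k).
by rewrite opprD opprB.
Qed.

(** Mutation is the product E B F of B with two integral involutions, each the
    identity up to one column of E and one row of F: hence F M E is a left
    inverse of the mutated matrix. *)
Lemma integral_section_mutation i B (M : 'M[int]_(n, n + r)) :
  sign_skew B -> M *m B = 1%:M -> exists M', M' *m matrix_mutation i B = 1%:M.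
Proof.
move=> [B0 _] MB.
pose u : 'cV[int]_(n + r) := \col_k ((posn (B k i))%:Z - (k == I i)%:Z * 2).
pose v : 'rV[int]_n := \row_j ((posn (- B (I i) j))%:Z - (j == i)%:Z * 2).
pose eI : 'rV[int]_(n + r) := delta_mx 0 (I i).
pose ei : 'cV[int]_n := delta_mx i 0.
pose E := 1%:M + u *m eI; pose F := 1%:M + ei *m v.
(* Reflections: 1 + a b with b a = -2 is an involution. *)
have refl p (a : 'cV[int]_p) (b : 'rV[int]_p) : b *m a = (- 2)%:M ->
    (1%:M + a *m b) *m (1%:M + a *m b) = 1%:M.
  move=> ba; rewrite mulmxDl mul1mx mulmxDr mulmx1 -!mulmxA.
  rewrite [b *m (a *m b)]mulmxA ba.
  rewrite mul_scalar_mx -scalemxAr -addrA; set c := a *m b.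
  by rewrite -[X in X + (X + _)]scale1r -!scalerDl scale0r addr0.
have EE : E *m E = 1%:M.
  apply: refl; rewrite -rowE; apply/matrixP => a b.
  by rewrite !ord1 !mxE /= eqxx B0.
have FF : F *m F = 1%:M.
  apply: refl; rewrite -colE; apply/matrixP => a b.
  by rewrite !ord1 !mxE /= eqxx B0 oppr0.
have BE : matrix_mutation i B = E *m B *m F.
  have -> : E *m B *m F =
      B + u *m row (I i) B + col i (B + u *m row (I i) B) *m v.
    rewrite mulmxDl mul1mx mulmxDr mulmx1 -!mulmxA -rowE.
    by rewrite [_ *m (ei *m v)]mulmxA colE.
  apply/matrixP => k j; transitivity (B k j
      + ((posn (B k i))%:Z - (k == I i)%:Z * 2) * B (I i) j
      + B k i * ((posn (- B (I i) j))%:Z - (j == i)%:Z * 2)); last first.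
    by rewrite !(mxE, big_ord1) B0; ring.
  have [->|ki] := eqVneq k (I i).
    by rewrite matrix_mutation_row B0 /posn /=; ring.
  have [->|ji] := eqVneq j i.
    by rewrite matrix_mutation_col B0 /posn /=; ring.
  by rewrite matrix_mutationE // posn_mul /=; ring.
exists (F *m M *m E); rewrite BE -!mulmxA [E *m (E *m _)]mulmxA EE mul1mx.
by rewrite [M *m _]mulmxA MB mul1mx FF.
Qed.

End MatrixMutation.

(** * Cluster mutations as LP mutations *)

(** Replacing one coordinate z_a by the inverse of z_a times a monomial z^c is
    a linear substitution on exponent vectors. *)
Lemma zmon_substitute (N : nat) (E : idomainType) (z : 'I_N -> E) (a : 'I_N)
    (c v : 'I_N -> int) : (forall k, z k \is a GRing.unit) ->
  zmon (set_coord z a (zmon z c / z a)) v =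
  zmon z (fun k => v k + (c k - (k == a)%:Z * 2) * v a).
Proof.
move=> zU; pose e k : int := (k == a)%:Z.
have ea : zmon z e = z a.
  rewrite /zmon (bigD1 a) //= /e eqxx expr1z big1 ?mulr1 // => k /negbTE ->.
  by rewrite expr0z.
rewrite zmonD // -zmonXz //.
have -> : zmon z (fun k => c k - (k == a)%:Z * 2) = zmon z c / z a / z a.
  rewrite -!ea -!zmonB //; apply: eq_zmon => // k.
  by rewrite /e mulr_natr mulr2n opprD addrA.
rewrite /zmon [LHS](bigD1 a) // [in RHS](bigD1 a) //= {1}/set_coord eqxx.
rewrite [RHS]mulrAC; congr (_ * _); last first.
  by apply: eq_bigr => k ka; rewrite /set_coord (negbTE ka).
rewrite -exprzMl ?unitrM ?unitrV ?zU ?zmon_unit //.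
by congr (_ ^ _); rewrite [RHS]mulrC divrK.
Qed.

Lemma zmon_split (n r : nat) (R E : idomainType) (h : {rmorphism R -> E})
    (x : 'I_n -> E) (y : 'I_r -> R) (z : 'I_(n + r) -> E)
    (e : 'I_(n + r) -> int) (j : 'I_n) : (forall f, y f \is a GRing.unit) ->
  (forall k, z (lshift r k) = x k) -> (forall f, z (rshift n f) = h (y f)) ->
  e (lshift r j) = 0 ->
  zmon z e = h (\prod_f y f ^ e (rshift n f)) *
    \prod_(k < n | k != j) x k ^ e (lshift r k).
Proof.
move=> yU zx zy ej; rewrite /zmon big_split_ord /= mulrC; congr (_ * _).
  by rewrite rmorph_prod; apply: eq_bigr => f _; rewrite rmorphXz ?zy.
rewrite (bigD1 j) //= ej expr0z mul1r.
by apply: eq_bigr => k _; rewrite zx.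
Qed.

Lemma leval0 (R : idomainType) (n : nat) (E : fieldType)
    (h : {rmorphism R -> E}) (f : {mpoly R[n]}) (y : 'I_n -> E) :
  leval h 0%MM f y = mmap h y f.
Proof. by rewrite /leval big1 ?divr1 // => k _; rewrite mnm0E expr0. Qed.

Section FractionConst.
Variables (R : idomainType) (n : nat).

Lemma fconst_is_zmod_morphism : zmod_morphism (@fconst R n).
Proof. by move=> c d; rewrite /fconst !rmorphB. Qed.
Lemma fconst_is_monoid_morphism : monoid_morphism (@fconst R n).
Proof. by split=> [|c d]; rewrite /fconst ?rmorph1 ?rmorphM. Qed.
HB.instance Definition _ :=
  GRing.isZmodMorphism.Build _ _ (@fconst R n) fconst_is_zmod_morphism.
HB.instance Definition _ :=
  GRing.isMonoidMorphism.Build _ _ (@fconst R n) fconst_is_monoid_morphism.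

Lemma val_mmap_lconst (y : 'I_n -> laurent R n) (p : {mpoly R[n]}) :
  val (mmap (@lconst R n) y p) = mmap (@fconst R n) (fun k => val (y k)) p.
Proof. exact: (rmorph_mmap _ (val : {rmorphism laurent R n -> _})). Qed.

End FractionConst.

Section Seeds.
Variables (n r : nat).
Local Notation S := (laurent int r).
Local Notation L := (laurent S n).
Local Notation I i := (lshift r i).
Local Notation K := (ambient S n).
Implicit Types (B : 'M[int]_(n + r, n)) (i j : 'I_n).

(** The integral left inverse of the matrix is what is left of the principal
    coefficients in every seed reached by mutations. *)
Definition unimodular_seed (t : cluster_seed n r) : Prop :=
  [/\ transcendence_basis (cs_cluster t),
      skew_symmetrizable (usubmx (cs_matrix t)) &
      exists M, M *m cs_matrix t = 1%:M].

Lemma unimodular_lp_seed t :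
  unimodular_seed t -> is_lp_seed (lp_seed_of_cluster_seed t).
Proof.
move=> [tr /skew_sign[B0 _] [M MB]]; split=> //= [i|i j|i].
- exact: exchange_irreducible MB.
- exact: exchange_ndvdX.
- by rewrite exchange_involves B0 eqxx.
Qed.

Lemma unimodular_mutation i t :
  unimodular_seed t -> unimodular_seed (cluster_mutation i t).
Proof.
move=> ut; have [tr sk [M MB]] := ut; have sg := skew_sign sk.
split=> /=; last exact: integral_section_mutation MB.
  have [_ /(_ i) [F0 _ _] _ /(_ i) Fi] := unimodular_lp_seed ut.
  exact: transcendence_basis_exchange F0 Fi tr.
exact: skew_mutation.
Qed.

Lemma exchange_mutation_self i B :
  exchange_poly (matrix_mutation i B) i = exchange_poly B i.
Proof.
rewrite !exchange_polyE addrC; congr (_ + _); apply: eq_bigr => k _;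
  by rewrite matrix_mutation_col ?opprK.
Qed.

Lemma cluster_mutationK i t : unimodular_seed t ->
  cluster_mutation i (cluster_mutation i t) = t.
Proof.
move=> ut; have [[ax _] _ _] := ut.
have [_ /(_ i) [F0 _ _] _ /(_ i) /involvesPn Fi] := unimodular_lp_seed ut.
case: t ut ax F0 Fi => x B /= ut ax F0 Fi.
rewrite /cluster_mutation /= matrix_mutationK exchange_mutation_self.
congr ClusterSeed; apply: boolp.funext => j; case: eqP => // ->; rewrite eqxx.
have -> : mmap (@of_S S n) (fun k : 'I_n => if k == i
    then mmap (@of_S S n) x (exchange_poly B i) / x i else x k)
    (exchange_poly B i) = mmap (@of_S S n) x (exchange_poly B i).
  exact: (mmap_set_coord _ x).
apply: divKf; exact: mmap_of_S_neq0.
Qed.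

(** A variable X_j that F_i involves occurs in exactly one of the two monomials,
    so that X_j = 0 leaves the other one. *)
Lemma exchange_coord0 (E : comNzRingType) (phi : {rmorphism {mpoly S[n]} -> E})
    B i j : phi 'X_j = 0 -> B (I j) i != 0 -> phi (exchange_poly B i) =
  \prod_(k | k != I j) phi (extended_var k) ^+
     posn (if B (I j) i < 0 then B k i else - B k i).
Proof.
move=> phij; rewrite rmorph_exchange.
have zero (e : 'I_(n + r) -> nat) : e (I j) != 0%N ->
    \prod_k phi (extended_var k) ^+ e k = 0.
  move=> e0; rewrite (bigD1 (I j)) //= extended_varl phij expr0n.
  by rewrite (negbTE e0) mul0r.
rewrite neq_lt => /orP[b0|b0].
  rewrite b0 [X in _ + X]zero ?addr0 /posn ?oppr_gt0 ?b0 ?abszN; last by lia.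
  by rewrite (bigD1 (I j)) //= extended_varl (lt_gtF b0) mul1r.
rewrite (lt_gtF b0) zero ?add0r /posn ?b0; last by lia.
by rewrite (bigD1 (I j)) //= oppr_gt0 (lt_gtF b0) mul1r.
Qed.

Lemma val_laurent_div (z : L) j : val (z / lvar S j) = val z / fvar S j.
Proof.
have jU := lvar_unit S j.
rewrite rmorphM; congr (_ * _).
exact: (rmorphV (val : {rmorphism L -> _}) jU).
Qed.

(** At a torus point with F_j = 0 and F_i <> 0, the divisibility by F_j of
    F_i with F_j / X_j substituted for X_j is refuted: the substitution makes
    X_j vanish, and leaves one monomial of F_i if F_i involves X_j, and F_i
    itself otherwise.  So no denominator is needed to form the exchange Laurent
    polynomial. *)
Lemma exchange_hat_trivial i t : unimodular_seed t ->
  hat_exponent (lp_seed_of_cluster_seed t) i 0%MM.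
Proof.
move=> [_ /skew_sign sg [M MB]]; split=> [|j ji]; first by rewrite mnm0E.
set B := cs_matrix t in sg M MB *; rewrite /= leval0 -/B.
pose y := set_coord (@lvar S n) j (lpoly (exchange_poly B j) / lvar S j).
exists (mmap (@lconst S n) y (exchange_poly B i)); split.
  rewrite val_mmap_lconst; apply: eq_mmap => // k; rewrite /y /set_coord.
  by case: eqP => // _; rewrite val_laurent_div.
pose s (l : 'I_n) : rat := if l == j then -1 else 1.
have s0 l : s l != 0 by rewrite /s; case: ifP.
have [f fF] := exchange_point MB s0; case=> c /(congr1 f).
have -> : f (c * lpoly (exchange_poly B j)) = 0.
  by have [u _ e] := fF j; rewrite rmorphM /= e /s eqxx subrr !mulr0.
move/eqP; apply/negP; have [bji|bji] := eqVneq (B (I j) i) 0.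
  have /involvesPn inv : ~~ involves (exchange_poly B i) j.
    by rewrite exchange_involves bji eqxx.
  rewrite /y mmap_set_coord // mmap_lpoly; have [u u0 ->] := fF i.
  by rewrite mulf_neq0 // /s [i == j]eq_sym (negbTE ji).
pose phi : {rmorphism {mpoly S[n]} -> rat} := f \o mmap (@lconst S n) y.
have phiX (k : 'I_n) : phi 'X_k = f (y k) by rewrite /= mmapXU.
rewrite -[f _]/(phi _) (exchange_coord0 _ bji).
  apply/prodf_neq0 => k kj; apply: expf_neq0.
  rewrite -unitfE; case: (split_ordP k) kj => [l ->|l ->] kj; last first.
    rewrite extended_varr /= mmapC; do 2!apply: rmorph_unit.
    exact: lvar_unit.
  rewrite extended_varl phiX /y /set_coord; have [lj|_] := eqVneq l j.
    by rewrite lj eqxx in kj.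
  by apply: rmorph_unit; exact: lvar_unit.
rewrite phiX /y /set_coord eqxx rmorphM /=; have [u _ ->] := fF j.
by rewrite /s eqxx subrr mulr0 mul0r.
Qed.

Lemma torus_varl i : torus_var (I i) = lvar S i.
Proof. by rewrite /torus_var extended_varl. Qed.

(** A Laurent monomial with zero exponent at x_j, in the shape required of the
    factor relating F_j' to the factors left in G_j. *)
Lemma zmon_torus_split j (e : 'I_(n + r) -> int) : e (I j) = 0 ->
  exists u : S, exists m : 'I_n -> int, u \is a GRing.unit /\
    zmon (@torus_var n r) e =
      lconst n u * \prod_(k < n | k != j) lvar S k ^ m k.
Proof.
move=> ej.
exists (\prod_(f < r) lvar int f ^ e (rshift n f)), (fun k => e (I k)).
split; first by rewrite unitr_prod // => f _; rewrite unitrXz // lvar_unit.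
apply: (@zmon_split n r S L (@lconst S n) (@lvar S n) (@lvar int r)) => //.
- exact: lvar_unit.
- exact: torus_varl.
- by move=> f; rewrite /torus_var extended_varr.
Qed.

Lemma irreducible_factor_unit i j (g : L) p : g \is a GRing.unit ->
  ~ irreducible_factor i j g p.
Proof.
move=> gU [[_ /negP pU _] _ nd [c ec]]; apply: pU; apply: lpoly_unit => //.
by move: gU; rewrite ec unitrM => /andP[].
Qed.

(** With s the sign of b_ij, setting x_j = 0 leaves in F_i the single monomial
    z^c with c_k = [s b_ki]_+.  It is a unit, so that there is no factor to
    remove from G_j.  Up to Laurent monomials, G_j is 1 + z^b' where b' comes
    from the j-th column by the linear substitution of [zmon_substitute]; this
    is exactly the mutation rule for the j-th column. *)
Lemma exchange_mutation_other i j B : sign_skew B -> j != i ->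
  B (I i) j != 0 ->
  exists g H : L,
    [/\ val g = leval (@fconst S n) 0%MM (exchange_poly B i)
                   (set_coord (@fvar S n) j 0),
        common_factors_removed i j g
          (mmap (@lconst S n) (set_coord (@lvar S n) i (g / lvar S i))
             (exchange_poly B j)) H &
        exists u : S, exists m : 'I_n -> int, u \is a GRing.unit /\
          lpoly (exchange_poly (matrix_mutation i B) j) =
            lconst n u * \prod_(k < n | k != j) lvar S k ^ m k * H].
Proof.
move=> [B0 Bs] ji bij; set z := @torus_var n r.
have zU k : z k \is a GRing.unit by exact: torus_var_unit.
have sij : (B (I j) i < 0) = (0 < B (I i) j) by rewrite Bs.
have sji : (0 < B (I j) i) = (B (I i) j < 0) by rewrite Bs.
pose sg (b : int) := if 0 < B (I i) j then b else - b.
pose c k : nat := posn (sg (B k i)).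
have cj : c (I j) = 0%N.
  rewrite /c /sg -sij; case: ifP => b; last by rewrite /posn oppr_gt0 b.
  by rewrite /posn (lt_gtF b).
have ci : c (I i) = 0%N by rewrite /c /sg B0 oppr0 if_same.
pose g := zmon z (fun k => c k).
have gU : g \is a GRing.unit by exact: zmon_unit.
pose phi : {rmorphism {mpoly S[n]} -> L} :=
  mmap (@lconst S n) (set_coord (@lvar S n) i (g / lvar S i)).
pose H := phi (exchange_poly B j).
exists g, H; split.
- rewrite leval0.
  have -> : mmap (@fconst S n) (set_coord (@fvar S n) j 0) (exchange_poly B i) =
      val (mmap (@lconst S n) (set_coord (@lvar S n) j 0) (exchange_poly B i)).
    rewrite val_mmap_lconst; apply: eq_mmap => // k; rewrite /set_coord.
    by case: eqP => // _; rewrite rmorph0.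
  congr val; rewrite (exchange_coord0 (phi := mmap (@lconst S n) _) (j := j)).
  + rewrite /g /zmon (bigD1 (I j)) //= cj mul1r; apply: eq_bigr => k kj.
    rewrite sij /c /sg -exprnP; congr (_ ^+ _).
    rewrite /z /torus_var; case: (split_ordP k) kj => [l ->|l ->] kj.
      rewrite extended_varl mmapXU /set_coord; have [lj|//] := eqVneq l j.
      by rewrite lj eqxx in kj.
    by rewrite extended_varr mmapC.
  + by apply: etrans (mmapXU (@lconst S n) _ j) _; rewrite /set_coord eqxx.
  + apply: contraNneq bij => b0; move: sij sji; rewrite b0 ltxx.
    by case: ltgtP.
- exists [::]; split=> [//||p pf]; first by rewrite big_nil mul1r.
  by case: (irreducible_factor_unit gU pf).
have phiz k : phi (extended_var k) = set_coord z (I i) (g / z (I i)) k.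
  case: (split_ordP k) => [l ->|l ->].
    rewrite extended_varl /= mmapXU /set_coord (inj_eq (@lshift_inj _ _)).
    by rewrite /z !torus_varl.
  rewrite extended_varr /= mmapC /set_coord eq_rlshift.
  by rewrite /z /torus_var extended_varr.
have phiU k : phi (extended_var k) \is a GRing.unit.
  rewrite phiz /set_coord; case: eqP => // _.
  by rewrite unitrM unitrV gU zU.
have phi_zmon (v : 'I_(n + r) -> int) :
    zmon (phi \o @extended_var n r) v =
    zmon z (fun k => v k + ((c k)%:Z - (k == I i)%:Z * 2) * v (I i)).
  apply: etrans (zmon_substitute (I i) (fun k => (c k)%:Z) v zU).
  exact: eq_zmon phiz (fun=> erefl).
(* The exponents of the monomial F_j' / G_j; the one at x_j vanishes, because
   b_jj = 0 and z^c does not contain x_j. *)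
pose e k : int := (posn (- matrix_mutation i B k j))%:Z - ((posn (- B k j))%:Z
  + ((c k)%:Z - (k == I i)%:Z * 2) * (posn (- B (I i) j))%:Z).
have column k : matrix_mutation i B k j =
    B k j + ((c k)%:Z - (k == I i)%:Z * 2) * B (I i) j.
  have [->|ki] := eqVneq k (I i).
    by rewrite matrix_mutation_row ci /=; ring.
  rewrite matrix_mutationE // /c /sg mul0r subr0; congr (_ + _).
  rewrite {2 4}/posn oppr_gt0.
  by case: (ltgtP (B (I i) j) 0) bij => // b _; lia.
have [|u [m [uU em]]] := @zmon_torus_split j e.
  have cz : (c (I j))%:Z - (I j == I i)%:Z * 2 = 0.
    by rewrite cj (inj_eq (@lshift_inj _ _)) (negbTE ji).
  by rewrite /e column B0 cz !mul0r.
exists u, m; split=> //; rewrite -em.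
rewrite [lpoly _](torus_exchange (f := @lpoly S n)) //.
rewrite /H torus_exchange // !phi_zmon mulrA; congr (_ * (1 + _)).
  by rewrite /e zmonB // divrK // zmon_unit.
exact: eq_zmon.
Qed.

Theorem cluster_mutation_lp i t : unimodular_seed t ->
  lp_mutation i (lp_seed_of_cluster_seed t)
    (lp_seed_of_cluster_seed (cluster_mutation i t)).
Proof.
move=> ut; have [_ /skew_sign sg [M MB]] := ut.
have [_ _ ndvd noself] := unimodular_lp_seed (unimodular_mutation i ut).
split; first exact: unimodular_lp_seed.
exists 0%MM; split=> [|j||j ji].
- exact: exchange_hat_trivial.
- by rewrite leval0.
- exact: exchange_mutation_self.
rewrite /= exchange_involves negbK; case: ifP => [/eqP bij|/negbT bij].
  exists 1; rewrite ?unitr1 // scale1r !exchange_polyE.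
  suff e k : matrix_mutation i (cs_matrix t) k j = cs_matrix t k j.
    by congr (_ + _); apply: eq_bigr => k _; rewrite e.
  have [->|ki] := eqVneq k (I i).
    by rewrite matrix_mutation_row bij oppr0.
  by rewrite matrix_mutationE // posn_mul bij !mulr0 !addr0.
have [g [H [gE Hrem Hprop]]] := exchange_mutation_other sg ji bij.
by exists g, H; split=> //; [exact: noself | exact: ndvd].
Qed.

End Seeds.

(** * The LP algebra of a cluster algebra *)

Lemma is_cluster_varP (S : idomainType) (n : nat) (s : lp_seed S n) v :
  is_cluster_var (useed_of s) v <-> exists i, v = lp_cluster s i.
Proof.
split=> [[f /imfsetP[/= i _ [-> _]]]|[i ->]]; first by exists i.
exists (mmap (@of_S S n) (lp_cluster s) (lp_poly s i)).
by apply/imfsetP; exists i.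
Qed.

Lemma generated_subring_sub (S : idomainType) (n : nat)
    (X Y : ambient S n -> Prop) : (forall v, X v -> Y v) ->
  forall z, generated_subring X z -> generated_subring Y z.
Proof.
move=> XY z; elim=> [c|w /XY|w w' _ IH _ IH'|w w' _ IH _ IH'].
- exact: gen_const.
- exact: gen_elt.
- exact: gen_sub.
- exact: gen_mul.
Qed.

(** An unordered seed may come from several labelled seeds, and an LP algebra
    asks for one mutation per unordered seed and variable.  These are chosen so
    that the seeds are connected without any comparison of labelled seeds: an
    unordered seed is reached by a shortest word of mutations, whose last letter
    is undone by mutating at the variable that it introduced, and this is the
    mutation chosen at that variable.  Following these choices leads from every
    seed back to the initial one. *)
Section Exploration.
Variables (n r : nat) (t0 : cluster_seed n r).
Hypothesis ut0 : unimodular_seed t0.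
Local Notation K := (ambient (laurent int r) n).
Local Notation useed := {fset K * K}.
Local Notation C := (cluster_lp_seeds t0).

Definition word_seed (w : seq 'I_n) := foldr (@cluster_mutation n r) t0 w.
Definition word_useed (w : seq 'I_n) : useed :=
  useed_of (lp_seed_of_cluster_seed (word_seed w)).

Lemma reachable_word t :
  cluster_reachable t0 t <-> exists w, t = word_seed w.
Proof.
split=> [|[w ->]].
  by elim=> [|t' i _ [w ->]]; [exists [::] | exists (i :: w)].
by elim: w => [|i w IH]; [exact: reach_refl | exact: reach_mut].
Qed.

Lemma cluster_lp_seedsP U : C U <-> exists w, U = word_useed w.
Proof.
split=> [[t /reachable_word[w ->] ->]|[w ->]]; first by exists w.
by exists (word_seed w) => //; apply/reachable_word; exists w.
Qed.

Lemma word_seed_unimodular w : unimodular_seed (word_seed w).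
Proof. by elim: w => //= i w; exact: unimodular_mutation. Qed.

Lemma word_ulp_mutation i w :
  ulp_mutation (cs_cluster (word_seed w) i)
    (word_useed w) (word_useed (i :: w)).
Proof.
exists i, (lp_seed_of_cluster_seed (word_seed w)),
  (lp_seed_of_cluster_seed (word_seed (i :: w))); split=> //.
exact/cluster_mutation_lp/word_seed_unimodular.
Qed.

Lemma shortest_word U : C U ->
  exists2 w, U = word_useed w &
    forall w', U = word_useed w' -> (size w <= size w')%N.
Proof.
move=> /cluster_lp_seedsP[w0 e0].
pose P m := boolp.asbool (exists2 w, size w = m & U = word_useed w).
have exP : exists m, P m by exists (size w0); apply/boolp.asboolP; exists w0.
case: (ex_minnP exP) => m /boolp.asboolP[w <- e] min; exists w => // w' e'.
by apply: min; apply/boolp.asboolP; exists w'.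
Qed.

Lemma cluster_lp_seeds_algebra : is_lp_algebra (cluster_algebra t0) C.
Proof.
split=> [U [t /reachable_word[w ->] ->]|].
  exists (lp_seed_of_cluster_seed (word_seed w)) => //.
  exact/unimodular_lp_seed/word_seed_unimodular.
have [sw swP] : exists sw : useed -> seq 'I_n, forall U, C U ->
    U = word_useed (sw U) /\
    (forall w', U = word_useed w' -> (size (sw U) <= size w')%N).
  have /boolp.choice[sw swP] : forall U : useed, exists w, C U ->
      U = word_useed w /\
      (forall w', U = word_useed w' -> (size w <= size w')%N).
    move=> U; case: (boolp.pselect (C U)) => [CU|nC]; last by exists [::].
    by have [w e m] := shortest_word CU; exists w.
  by exists sw.
pose to_parent U v i w :=
  sw U = i :: w /\ v = cs_cluster (word_seed (i :: w)) i.
have /boolp.choice[mu muP] : forall Uv : useed * _, exists U' : useed,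
    C Uv.1 -> is_cluster_var Uv.1 Uv.2 ->
    [/\ C U', ulp_mutation Uv.2 Uv.1 U' &
        forall i w, to_parent Uv.1 Uv.2 i w -> U' = word_useed w].
  move=> [U v] /=; case: (boolp.pselect (exists i w, to_parent U v i w)).
    move=> [i [w [eU ev]]]; exists (word_useed w) => CU _; split.
    - by apply/cluster_lp_seedsP; exists w.
    - have [e _] := swP U CU.
      have -> : word_useed w = word_useed [:: i, i & w].
        rewrite /word_useed /= cluster_mutationK //.
        exact: word_seed_unimodular.
      by rewrite {1}e eU ev; exact: word_ulp_mutation.
    - by move=> i' w' [+ _]; rewrite eU => -[_ ->].
  move=> npar; case: (boolp.pselect (C U /\ is_cluster_var U v)); last first.
    by move=> nC; exists U => CU cv; case: nC.
  move=> [/cluster_lp_seedsP[w eU] cv].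
  move: (cv); rewrite eU => /is_cluster_varP[i ev].
  exists (word_useed (i :: w)) => _ _; split.
  - by apply/cluster_lp_seedsP; exists (i :: w).
  - by rewrite ev; exact: word_ulp_mutation.
  - by move=> i' w' par; case: npar; exists i', w'; rewrite eU.
exists (fun U v => mu (U, v)); split.
- by move=> U v CU cv; case: (muP (U, v) CU cv).
(* The parent of a seed has a shorter word. *)
- pose conn := clos_refl_sym_trans _
    (fun V V' => C V /\ exists2 v, is_cluster_var V v & V' = mu (V, v)).
  suff root U : C U -> conn U (word_useed [::]).
    move=> U U' /root cU /root cU'; apply: rst_trans cU _; exact: rst_sym.
  move: {2}(size (sw U)) (leqnn (size (sw U))) => d.
  elim: d U => [|d IH] U sz CU.
    have [-> _] := swP U CU.
    by move: sz; rewrite leqn0 size_eq0 => /eqP ->; exact: rst_refl.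
  have [eU _] := swP U CU; case ew : (sw U) => [|i w].
    by rewrite eU ew; exact: rst_refl.
  pose v := cs_cluster (word_seed (i :: w)) i.
  have cv : is_cluster_var U v.
    by rewrite eU ew; apply/is_cluster_varP; exists i.
  have [CV _ eV] := muP (U, v) CU cv.
  apply: (rst_trans _ _ _ (mu (U, v))).
    by apply: rst_step; split=> //; exists v.
  apply: IH => //; have [_ /(_ w) min] := swP _ CV.
  apply: leq_trans (min _) _; first exact: (eV i w).
  by move: sz; rewrite ew.
- move=> z; split; apply: generated_subring_sub => v.
    move=> [t [i [/reachable_word[w ->] ->]]]; exists (word_useed w).
      by apply/cluster_lp_seedsP; exists w.
    by apply/is_cluster_varP; exists i.
  move=> [U [t rt ->] /is_cluster_varP[i ->]]; by exists t, i.
Qed.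

End Exploration.

Theorem corollary4p5 (n : nat) (n_ge1 : (1 <= n)%N) (t0 : cluster_seed n n)
    (t0_seed : is_cluster_seed t0)
    (t0_principal : dsubmx (cs_matrix t0) = 1%:M) :
  is_lp_algebra (cluster_algebra t0) (cluster_lp_seeds t0).
Proof.
have [tr sk] := t0_seed; apply: cluster_lp_seeds_algebra; split=> //.
exists (row_mx 0 1%:M); rewrite -[cs_matrix t0]vsubmxK mul_row_col.
by rewrite mul0mx mul1mx add0r.
Qed.
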